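(* Let $\beta$ be the Traveling Salesman constant for the unit square, i.e. the constant such that, for independent uniform random variables $X_1, X_2, \dots$ on $[0,1]^2$, $\lim_{n\to\infty} \frac{L(X_1,\dots,X_n)}{\sqrt{n}} = \beta$ almost surely. Then \[ \beta \geq \frac{5}{8} + \frac{1}{2}\left(\frac{19}{10368}\right) + \frac{1}{2}\left(\frac{3072\sqrt{2} - 4325}{5376}\right) \geq 0.6277. \]
   Context: For points $x_1,\dots,x_n \in [0,1]^2$, $L(x_1,\dots,x_n)$ denotes the length of the shortest Traveling Salesman tour (closed tour visiting all the points) through $x_1,\dots,x_n$, where distances are Euclidean, $d(x,y) = \Vert x-y\Vert_2$. By a theorem of Beardwood, Halton and Hammersley (1959), there exists a (deterministic) constant $\beta$ such that, for i.i.d. uniform random variables $X_1, X_2, \dots$ on $[0,1]^2$, $L(X_1,\dots,X_n)/\sqrt{n} \to \beta$ almost surely as $n \to \infty$. *)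

(* Defs.v *)
From mathcomp Require Export all_boot all_order all_algebra all_fingroup.
From mathcomp Require Export all_classical all_reals all_analysis.

Set Implicit Arguments.
Unset Strict Implicit.
Unset Printing Implicit Defensive.

Import Order.TTheory GRing.Theory Num.Theory.
Import numFieldNormedType.Exports.

Local Open Scope classical_set_scope.
Local Open Scope ring_scope.

(* The library norm on R * R is the maximum norm, hence this definition. *)
Definition eucl_dist {R : realType} (x y : R * R) : R :=
  Num.sqrt ((x.1 - y.1) ^+ 2 + (x.2 - y.2) ^+ 2).

(* [ordS] is the cyclic successor i |-> i + 1 mod n on 'I_n, so the tour
   x (s 0), ..., x (s (n - 1)) closes up. *)
Definition tour_length {R : realType} (n : nat) (x : 'I_n -> R * R)
    (s : 'S_n) : R :=
  \sum_(i < n) eucl_dist (x (s i)) (x (s (ordS i))).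

Definition tsp_length {R : realType} (n : nat) (x : 'I_n -> R * R) : R :=
  tour_length x [arg min_(s < 1%g : 'S_n) tour_length x s]%O.

Definition unit_square {R : realType} : set (R * R) :=
  `[0, 1]%classic `*` `[0, 1]%classic.

Definition mutually_independent {d d' : measure_display}
    {T : measurableType d} {T' : measurableType d'} {R : realType}
    (P : probability T R) (X : nat -> {RV P >-> T'}) : Prop :=
  forall (J : seq nat) (A : nat -> set T'), uniq J ->
    (forall i, i \in J -> measurable (A i)) ->
    P (\bigcap_(i in [set` J]) X i @^-1` A i) =
    (\prod_(i <- J) P (X i @^-1` A i))%E.
Arguments mutually_independent {d d' T T' R} P X.

(* The square has area 1, so no normalisation is needed. *)
Definition uniform_on_unit_square {d : measure_display} {T : measurableType d}
    {R : realType} (P : probability T R) (Y : {RV P >-> (R * R)%type}) : Prop :=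
  forall A : set (R * R), measurable A ->
    distribution P Y A =
    (lebesgue_measure \x lebesgue_measure)%E (A `&` unit_square).
Arguments uniform_on_unit_square {d T R} P Y.

Definition iid_uniform_unit_square {d : measure_display}
    {T : measurableType d} {R : realType} (P : probability T R)
    (X : nat -> {RV P >-> (R * R)%type}) : Prop :=
  mutually_independent P X /\ (forall i, uniform_on_unit_square P (X i)).
Arguments iid_uniform_unit_square {d T R} P X.

(* Main.v *)
Require Import Defs.
From mathcomp Require Import all_boot all_order all_algebra.
From mathcomp Require Import all_classical all_reals all_analysis.
From mathcomp Require Import ring lra zify.
Import Order.TTheory GRing.Theory Num.Theory.
Import numFieldNormedType.Exports.
Local Open Scope ring_scope.

(** The tour uses two edges at every point, so its length is half the sum,
    over the points i, of the lengths of the two tour edges at i.  These are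
    at least D1(i) and D2(i), the distances from i to its nearest and second
    nearest point.  For n uniform points D1 and D2 have means close to
    1 / (2 sqrt n) and 3 / (4 sqrt n), which already gives beta >= 5/8.

    The improvement over 5/8 comes from isolated points.  Measure lengths in
    units of 1 / sqrt n and call j isolated if no other point lies within s.
    An isolated point is one of the two nearest points of fewer than two other
    points on average, but the tour reaches it from two points.  A point i
    joined to j by the tour spends at least d(i,j) - D2(i) more than its share
    D1(i) + D2(i), and d(i,j) - D2(i) is at least u times the number of
    k <= q such that i has two points within d(i,j) - k u.  Collecting this
    excess at j, an isolated j contributes at least
    u * sum_k (2 - #{i : i has at most one point within d(i,j) - k u}).
    The mean of that cardinal is a Poisson computation.  The one geometric
    input is that a disc around i of radius at most d(i,j) contains at most
    half of the empty disc around j, because it cannot contain two points that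
    are symmetric about j ([lens_half]).  So the disc around i has an area at
    least pi (d(i,j) - k u)^2 - pi s^2 / 2 outside the empty one.  With
    pi s^2 = 2, u = 3 s / 100 and q = 5 the gain exceeds the one in the
    statement by more than a tenth.

    To make all means finite sums, take n = M^2 points, cut the square into
    M^2 * M^2 cells and replace every point by its cell.  This changes
    L / sqrt n by O(1 / M), and the cells are independent and uniform, so that
    probabilities are cardinals of sets of functions ([mean_occupancy]).  The
    cells in a disc are counted with error O(radius) by comparing a sum of
    half-chords with circular sectors.  [score] is the resulting lower bound
    for twice the length, [mean_score_floor] the limit of its mean as M grows.
    As [score] is bounded above, its mean cannot exceed asymptotically what
    the almost sure limit beta allows; this is [score_limit_le].  The rest is
    calculus: the term 5/8 is a Gaussian integral ([gauss_riemann_sum]) and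
    the gain is estimated in [score_limit_ge]. *)

Set Implicit Arguments.
Unset Strict Implicit.
Unset Printing Implicit Defensive.


(** * The excess of a tour over the two-nearest-points bound *)

Section Vertex.
Variable R : realType.

Lemma threshold_count_le (P : nat -> bool) (e x : R) (T : nat) :
  0 <= e -> 0 <= x -> (forall k, P k -> k.+1%:R * e <= x) ->
  e * \sum_(k < T) (P k)%:R <= x.
Proof.
move=> e0 x0 HP; elim: T => [|T IH]; first by rewrite big_ord0 mulr0.
case PT: (P T); last by rewrite big_ord_recr /= PT addr0.
apply: le_trans (HP _ PT); rewrite mulrC ler_wpM2r//.
have -> : (T.+1%:R : R) = \sum_(k < T.+1) 1 by rewrite sumr_const card_ord.
by apply: ler_sum => k _; case: (P k); rewrite ?ler01.
Qed.

(** One tour edge of length [x] at a vertex, where [c t] is the number of points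
    within [t].  The first sum is a discretised distance to the nearest
    ([b = 0]) or second nearest ([b = 1]) point, the second one is what the edge
    can spend beyond it.  Edges longer than [cut] can spend anything, at the
    price of the factor [1 + eta]: this makes only finitely many distances
    matter later. *)
Lemma vertex_excess (c : R -> nat) (b T q : nat) (e U eta cut x : R) :
  {homo c : s t / s <= t >-> (s <= t)%N} -> (forall t, t <= 0 -> c t = 0%N) ->
  (b <= 1)%N -> (forall t, (c t <= b)%N -> t <= x) ->
  0 <= e -> 0 <= U -> 0 <= eta -> q%:R * U <= eta * cut -> 0 <= x ->
  e * \sum_(k < T) (c (k.+1%:R * e)%R <= b)%N%:R
  + U * \sum_(k < q) (1 - ((x <= cut) && (c (x - k.+1%:R * U)%R <= 1)%N)%:R)
    <= (1 + eta) * x.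
Proof.
move=> cmono c0 b1 hx e0 U0 eta0 HqU x0.
set z := e * _.
have zx : z <= x.
  by apply: (threshold_count_le (P := fun k => (c (k.+1%:R * e)%R <= b)%N)) => // k /hx.
have [xc|cx] := leP x cut; last first.
  have : U * (\sum_(k < q) (1 - (false && (c (x - k.+1%:R * U)%R <= 1)%N)%:R)) = q%:R * U.
    by under eq_bigr do rewrite subr0; rewrite sumr_const card_ord mulrC.
  move=> ->; have : eta * cut <= eta * x by rewrite ler_wpM2l// ltW.
  by move=> h; rewrite mulrDl mul1r; apply: lerD => //; exact: le_trans h.
suff : forall q', z + U * \sum_(k < q') (1 - (c (x - k.+1%:R * U)%R <= 1)%N%:R) <= x.
  move=> /(_ q) h; apply: le_trans h _.
  by rewrite mulrDl mul1r lerDl mulr_ge0.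
elim=> [|q' IH]; first by rewrite big_ord0 mulr0 addr0.
have [good|bad] := leqP (c (x - q'.+1%:R * U)) 1.
  by rewrite big_ord_recr/= good subrr addr0.
have hpos : 0 <= x - q'.+1%:R * U.
  by rewrite leNgt; apply/negP => /ltW /c0 h; rewrite h in bad.
(* Two points lie within [x - q'.+1 * U], so no threshold beyond it is counted
   in [z]. *)
have zz : z <= x - q'.+1%:R * U.
  apply: (threshold_count_le (P := fun k => (c (k.+1%:R * e)%R <= b)%N)) => // k ck.
  rewrite leNgt; apply/negP => /ltW /cmono h.
  by have := leq_trans bad h; rewrite ltnNge (leq_trans ck b1).
rewrite -lerBrDr; apply: le_trans zz _; rewrite lerD2l lerN2 mulrC ler_wpM2r//.
have -> : (q'.+1%:R : R) = \sum_(k < q'.+1) 1 by rewrite sumr_const card_ord.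
by apply: ler_sum => k _; rewrite lerBlDr lerDl.
Qed.
End Vertex.

Section TourExcess.
Variables (R : realType) (n : nat) (D : 'I_n -> 'I_n -> R).

Definition near_count (i : 'I_n) (t : R) : nat :=
  #|[set l | (l != i) && (D i l < t)]|.

Lemma near_count_homo i : {homo near_count i : s t / s <= t >-> (s <= t)%N}.
Proof.
move=> s t st; apply/subset_leq_card/fintype.subsetP => l; rewrite !inE.
by move=> /andP[-> /= h]; exact: lt_le_trans h st.
Qed.

Hypotheses (D0 : forall i l, 0 <= D i l) (Dsym : forall i l, D i l = D l i).

Lemma near_count_le0 i t : t <= 0 -> near_count i t = 0%N.
Proof.
move=> t0; apply/eqP; rewrite cards_eq0; apply/eqP/setP => l; rewrite !inE.
by rewrite ltNge (le_trans t0)// andbF.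
Qed.

(** The part of the excess of [i] that an edge from [i] to [j] makes available
    to [j]. *)
Definition payment (U cut : R) (q : nat) (i j : 'I_n) : R :=
  U * \sum_(k < q) (1 - ((D i j <= cut) && (near_count i (D i j - k.+1%:R * U)%R <= 1)%N)%:R).

(** The shorter edge is charged to the nearest point and the longer one to the
    second nearest; each of them separately leaves its payment. *)
Lemma two_edges_excess (e U eta cut : R) (T q : nat) (i a b : 'I_n) :
  a != i -> b != i -> a != b ->
  0 <= e -> 0 <= U -> 0 <= eta -> q%:R * U <= eta * cut ->
  e * \sum_(k < T) ((near_count i (k.+1%:R * e)%R <= 0)%N%:R
                    + (near_count i (k.+1%:R * e)%R <= 1)%N%:R)
  + (payment U cut q i a + payment U cut q i b)
    <= (1 + eta) * (D i a + D i b).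
Proof.
move=> ai bi ab e0 U0 eta0 HqU.
wlog Dab : a b ai bi ab / D i a <= D i b.
  move=> H; have [h|/ltW h] := leP (D i a) (D i b); first exact: H.
  by rewrite [D i a + _]addrC [payment _ _ _ _ _ + _]addrC; apply: H; rewrite // eq_sym.
have va := @vertex_excess R (near_count i) 0 T q e U eta cut (D i a)
  (@near_count_homo i) (@near_count_le0 i) isT.
have vb := @vertex_excess R (near_count i) 1 T q e U eta cut (D i b)
  (@near_count_homo i) (@near_count_le0 i) isT.
rewrite big_split/= mulrDr mulrDr addrACA; apply: lerD.
- apply: va => // t; rewrite leqn0 cards_eq0 => /eqP h; rewrite leNgt; apply/negP => ht.
  by have := finset.in_set0 a; rewrite -h inE ai ht.
- apply: vb => // t h; rewrite leNgt; apply/negP => ht.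
  have : (#|[set a; b]| <= near_count i t)%N.
    apply/subset_leq_card/fintype.subsetP => l; rewrite !inE => /orP[/eqP ->|/eqP ->].
      by rewrite ai (le_lt_trans Dab ht).
    by rewrite bi ht.
  by rewrite cards2 ab => h'; have := leq_trans h' h.
Qed.

(** Summing over the vertices counts each edge twice, once at each end; the
    payments are then regrouped at their receiving end.  The two tour neighbours
    of [j] are distinct, so replacing them by all [i != j] only loses. *)
Lemma cycle_excess (sigma : {perm 'I_n}) (iso : pred 'I_n) (e U eta cut : R) (T q : nat) :
  (forall i, sigma i != i) -> (forall i, sigma (sigma i) != i) ->
  0 <= e -> 0 <= U -> 0 <= eta -> q%:R * U <= eta * cut ->
  \sum_i e * \sum_(k < T) ((near_count i (k.+1%:R * e)%R <= 0)%N%:R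
                    + (near_count i (k.+1%:R * e)%R <= 1)%N%:R)
  + \sum_(j | iso j) U * \sum_(k < q) (2 - \sum_(i | i != j)
      ((D i j <= cut) && (near_count i (D i j - k.+1%:R * U)%R <= 1)%N)%:R)
   <= (1 + eta) * (2 * \sum_i D i (sigma i)).
Proof.
move=> s1 s2 e0 U0 eta0 HqU.
have sV i : (sigma^-1)%g i != i.
  by apply/negP => /eqP h; have := s1 i; rewrite -{1}h permKV eqxx.
have ssV i : sigma i != (sigma^-1)%g i.
  by apply/negP => /eqP h; have := s2 i; rewrite h permKV eqxx.
have E : 2 * \sum_i D i (sigma i) = \sum_i (D i (sigma i) + D i ((sigma^-1)%g i)).
  rewrite big_split/= mulr_natl mulr2n; congr (_ + _).
  rewrite [RHS](reindex_inj (@perm_inj _ sigma))/=.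
  by apply: eq_bigr => i _; rewrite permK Dsym.
have H i : e * \sum_(k < T) ((near_count i (k.+1%:R * e)%R <= 0)%N%:R
                    + (near_count i (k.+1%:R * e)%R <= 1)%N%:R)
  + (payment U cut q i (sigma i) + payment U cut q i ((sigma^-1)%g i))
    <= (1 + eta) * (D i (sigma i) + D i ((sigma^-1)%g i)).
  exact: two_edges_excess.
rewrite E mulr_sumr.
apply: (@le_trans _ _ (\sum_i (e * \sum_(k < T) ((near_count i (k.+1%:R * e)%R <= 0)%N%:R
        + (near_count i (k.+1%:R * e)%R <= 1)%N%:R)
    + (payment U cut q i (sigma i) + payment U cut q i ((sigma^-1)%g i)))));
  last by apply: ler_sum => i _; exact: H.
rewrite big_split/= lerD2l big_split/=.
rewrite [X in _ <= X + _](reindex_inj (@perm_inj _ (sigma^-1)%g))/=.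
rewrite [X in _ <= _ + X](reindex_inj (@perm_inj _ sigma))/=.
rewrite -big_split/=.
have un0 i j : 0 <= payment U cut q i j.
  by rewrite mulr_ge0// sumr_ge0// => k _; rewrite subr_ge0; case: (_ && _); rewrite ?ler01.
rewrite [leRHS](bigID iso)/=; apply: ler_wpDr.
  by apply: sumr_ge0 => j _; rewrite addr_ge0.
apply: ler_sum => j _; rewrite /payment permK permKV -mulrDr -big_split/= ler_wpM2l//.
apply: ler_sum => k _.
rewrite (bigD1 ((sigma^-1)%g j)) ?sV//= (bigD1 (sigma j))/=; last by rewrite s1 ssV.
set X := \sum_(i | _) _.
have X0 : 0 <= X by apply: sumr_ge0 => i _.
set A := (_ && _)%:R; set B := (_ && _)%:R; lra.
Qed.

End TourExcess.


(** * From tours of points to tours of grid cells *)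

Section Tour.
Variable R : realType.

Lemma tour_length_succ n (x : 'I_n -> R * R) (s : 'S_n) : (2 < n)%N ->
  exists sigma : {perm 'I_n},
    [/\ forall i, sigma i != i, forall i, sigma (sigma i) != i
      & tour_length x s = \sum_i eucl_dist (x i) (x (sigma i))].
Proof.
move=> n3; exists (s^-1 * perm (@ordS_inj n) * s)%g.
have E i : (s^-1 * perm (@ordS_inj n) * s)%g i = s (ordS ((s^-1)%g i)).
  by rewrite !permM permE.
have o1 (j : 'I_n) : ordS j != j.
  apply/negP => /eqP/(congr1 val)/=; have := ltn_ord j.
  rewrite leq_eqVlt => /orP[/eqP h|h]; last first.
    by rewrite modn_small// => /eqP; rewrite -{2}[val j]addn0 -addn1 eqn_add2l.
  by rewrite h modnn => h0; rewrite -h0 in h; rewrite -h in n3.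
have o2 (j : 'I_n) : ordS (ordS j) != j.
  apply/negP => /eqP/(congr1 val)/=.
  have := ltn_ord j; rewrite leq_eqVlt => /orP[/eqP h|h].
    by rewrite h modnn modn_small; lia.
  rewrite (modn_small h); move: h; rewrite leq_eqVlt => /orP[/eqP h|h].
    by rewrite h modnn; lia.
  by rewrite modn_small; lia.
split.
- by move=> i; rewrite E; apply/negP => /eqP h; have := o1 ((s^-1)%g i); rewrite -{2}h permK eqxx.
- move=> i; rewrite !E permK; apply/negP => /eqP h.
  by have := o2 ((s^-1)%g i); rewrite -{2}h permK eqxx.
- rewrite /tour_length [RHS](reindex_inj (@perm_inj _ s))/=.
  by apply: eq_bigr => i _; rewrite E permK.
Qed.

Lemma tsp_excess n (x : 'I_n -> R * R) (D : 'I_n -> 'I_n -> R) (err scale : R)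
   (iso : pred 'I_n) (e U eta cut : R) (T q : nat) : (2 < n)%N ->
  (forall i l, 0 <= D i l) -> (forall i l, D i l = D l i) ->
  (forall i l, D i l <= scale * eucl_dist (x i) (x l) + err) ->
  0 <= e -> 0 <= U -> 0 <= eta -> q%:R * U <= eta * cut ->
  \sum_i e * \sum_(k < T) ((near_count D i (k.+1%:R * e)%R <= 0)%N%:R
                    + (near_count D i (k.+1%:R * e)%R <= 1)%N%:R)
  + \sum_(j | iso j) U * \sum_(k < q) (2 - \sum_(i | i != j)
      ((D i j <= cut) && (near_count D i (D i j - k.+1%:R * U)%R <= 1)%N)%:R)
   <= (1 + eta) * (2 * (scale * tsp_length x + n%:R * err)).
Proof.
move=> n3 D0 Ds Dx e0 U0 eta0 HqU.
rewrite /tsp_length; set s := [arg min_(_ < _) _]%O.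
have [sigma [s1 s2 ->]] := tour_length_succ x s n3.
apply: le_trans (cycle_excess D0 Ds iso T s1 s2 e0 U0 eta0 HqU) _.
rewrite ler_wpM2l ?addr_ge0// ler_wpM2l// mulr_sumr.
have -> : n%:R * err = \sum_(i < n) err by rewrite sumr_const card_ord mulr_natl.
by rewrite -big_split/=; apply: ler_sum => i _.
Qed.

Lemma sqrtr_add_sqr_le (a b c d : R) :
  Num.sqrt ((a + c) ^+ 2 + (b + d) ^+ 2)
    <= Num.sqrt (a ^+ 2 + b ^+ 2) + Num.sqrt (c ^+ 2 + d ^+ 2).
Proof.
set p := a ^+ 2 + b ^+ 2; set r := c ^+ 2 + d ^+ 2.
have p0 : 0 <= p by rewrite addr_ge0 ?sqr_ge0.
have r0 : 0 <= r by rewrite addr_ge0 ?sqr_ge0.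
have cs : a * c + b * d <= Num.sqrt p * Num.sqrt r.
  rewrite -sqrtrM//; apply: le_trans (ler_norm _) _.
  rewrite -sqrtr_sqr ler_sqrt ?mulr_ge0//.
  have : 0 <= (a * d - b * c) ^+ 2 by exact: sqr_ge0.
  rewrite /p /r; nra.
rewrite -(ler_pXn2r (n := 2))// ?nnegrE ?addr_ge0 ?sqrtr_ge0//.
rewrite sqr_sqrtr ?addr_ge0 ?sqr_ge0// [leRHS]sqrrD !sqr_sqrtr//.
rewrite mulr2n /p /r; nra.
Qed.

Definition grid_point {G : nat} (v : 'I_G * 'I_G) : R * R := (v.1%:R, v.2%:R).

Lemma grid_dist_le G (v w : 'I_G * 'I_G) (x y : R * R) :
  (0 < G)%N ->
  [/\ v.1%:R <= G%:R * x.1 < v.1.+1%:R, v.2%:R <= G%:R * x.2 < v.2.+1%:R,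
      w.1%:R <= G%:R * y.1 < w.1.+1%:R & w.2%:R <= G%:R * y.2 < w.2.+1%:R] ->
  eucl_dist (grid_point v) (grid_point w) <= G%:R * eucl_dist x y + 2.
Proof.
move=> G0 [/andP[a1 a2] /andP[b1 b2] /andP[c1 c2] /andP[d1 d2]].
rewrite -!natr1 in a2 b2 c2 d2.
rewrite /eucl_dist /grid_point/=.
set A := G%:R * (x.1 - y.1); set B := G%:R * (x.2 - y.2).
have -> : G%:R * Num.sqrt ((x.1 - y.1) ^+ 2 + (x.2 - y.2) ^+ 2) = Num.sqrt (A ^+ 2 + B ^+ 2).
  rewrite /A /B !exprMn -mulrDr sqrtrM ?sqr_ge0// sqrtr_sqr ger0_norm//.
set C := v.1%:R - w.1%:R - A; set E := v.2%:R - w.2%:R - B.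
have -> : v.1%:R - w.1%:R = A + C by rewrite /C; ring.
have -> : v.2%:R - w.2%:R = B + E by rewrite /E; ring.
apply: le_trans (sqrtr_add_sqr_le _ _ _ _) _; rewrite lerD2l.
have -> : (2 : R) = Num.sqrt (2 ^+ 2) by rewrite sqrtr_sqr ger0_norm.
have C1 : C ^+ 2 <= 1 by rewrite /C /A; nra.
have E1 : E ^+ 2 <= 1 by rewrite /E /B; nra.
by rewrite ler_sqrt; nra.
Qed.

End Tour.


(** * Counting grid points in a disc *)

Section DiscSegments.
Variable R : realType.

Lemma ge0_derive_le (f df : R -> R) (a b : R) : a <= b ->
  (forall x : R, is_derive x 1 f (df x)) ->
  (forall x, a <= x <= b -> 0 <= df x) -> f a <= f b.
Proof.
move=> ab fdf df0.
have cf : ({within `[a, b], continuous f})%classic.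
  by apply: derivable_within_continuous => x _; have [] := fdf x.
have [c cab E] := MVT_segment ab (fun x _ => fdf x) cf.
by rewrite -subr_ge0 E mulr_ge0 ?subr_ge0// df0.
Qed.

(** The middle is the area under the unit circle between the abscissas [sin a]
    and [sin b], so this is the comparison with the two rectangles.  The angle is
    the variable because the arcsine is not differentiable at 1. *)
Lemma sector_segment_bounds (a b : R) : 0 <= a -> a <= b -> b <= pi / 2 ->
  cos b * (sin b - sin a) <= 2^-1 * (b + sin b * cos b) - 2^-1 * (a + sin a * cos a)
    <= cos a * (sin b - sin a).
Proof.
move=> a0 ab bpi.
have cos_le x y : 0 <= x -> x <= y -> y <= pi / 2 -> cos y <= cos x.
  move=> x0 xy ypi; rewrite le_eqVlt in xy; case/orP: xy => [/eqP ->//|xy].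
  have ppi : (pi / 2 : R) <= pi by rewrite ler_pdivrMr// ler_peMr ?pi_ge0// ler1n.
  apply: ltW; rewrite ltr_cos// in_itv/=; apply/andP; split; try lra.
have cos_pos x : 0 <= x -> x <= pi / 2 -> 0 <= cos x.
  by move=> x0 xpi; apply: cos_ge0_pihalf; have := pi_ge0 R; lra.
have dG (x : R) : is_derive x (1 : R) (fun x : R => 2^-1 * (x + sin x * cos x)) (cos x ^+ 2).
  apply: is_derive_eq.
  have := cos2Dsin2 x; rewrite /GRing.scale/=; nra.
have d1 (x : R) : is_derive x (1 : R) (fun x : R => 2^-1 * (x + sin x * cos x) - cos b * sin x)
    (cos x ^+ 2 - cos b * cos x).
  by apply: is_derive_eq; rewrite /GRing.scale/=; ring.
have d2 (x : R) : is_derive x (1 : R) (fun x : R => cos a * sin x - 2^-1 * (x + sin x * cos x))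
    (cos a * cos x - cos x ^+ 2).
  by apply: is_derive_eq; rewrite /GRing.scale/=; ring.
apply/andP; split.
- have := @ge0_derive_le
    (fun x : R => 2^-1 * (x + sin x * cos x) - cos b * sin x)
    (fun x => cos x ^+ 2 - cos b * cos x) a b ab.
  move=> H; suff : 2^-1 * (a + sin a * cos a) - cos b * sin a <=
    2^-1 * (b + sin b * cos b) - cos b * sin b by lra.
  apply: H => x /andP[ax xb].
  have -> : cos x ^+ 2 - cos b * cos x = cos x * (cos x - cos b) by ring.
  by rewrite mulr_ge0 ?subr_ge0 ?cos_le ?cos_pos//; lra.
- have := @ge0_derive_le
    (fun x : R => cos a * sin x - 2^-1 * (x + sin x * cos x))
    (fun x => cos a * cos x - cos x ^+ 2) a b ab.
  move=> H; suff : cos a * sin a - 2^-1 * (a + sin a * cos a) <=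
    cos a * sin b - 2^-1 * (b + sin b * cos b) by lra.
  apply: H => x /andP[ax xb].
  have -> : cos a * cos x - cos x ^+ 2 = cos x * (cos a - cos x) by ring.
  by rewrite mulr_ge0 ?subr_ge0 ?cos_le ?cos_pos//; lra.
Qed.

End DiscSegments.


Section HalfChords.
Variable R : realType.
Variable t : R.
Hypothesis t0 : 0 < t.

Definition half_chord (k : nat) : R := Num.sqrt (t ^+ 2 - k%:R ^+ 2).

(** [A k] is the area of the quarter disc of radius [t] over the abscissas at most
   [k]; truncating at 1 lets [k] exceed [t]. *)
Let s (k : nat) : R := Num.min (k%:R / t) 1.
Let th (k : nat) : R := asin (s k).
Let A (k : nat) : R := t ^+ 2 * (2^-1 * (th k + sin (th k) * cos (th k))).

Let s01 k : 0 <= s k <= 1.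
Proof. by rewrite /s ge_min lexx orbT le_min ler01 andbT divr_ge0// ltW. Qed.

Let sN1 k : -1 <= s k <= 1.
Proof. by have := s01 k; lra. Qed.

Let sinE k : sin (th k) = s k.
Proof. by rewrite /th asinK// in_itv/= sN1. Qed.

Let cosE k : t * cos (th k) = half_chord k.
Proof.
rewrite /th cos_asin ?sN1// /half_chord -{1}(ger0_norm (ltW t0)) -sqrtr_sqr -sqrtrM ?sqr_ge0//.
rewrite /s; case: (leP (k%:R / t) 1) => h.
  by congr Num.sqrt; field; rewrite gt_eqF.
have kt : t < k%:R by move: h; rewrite ltr_pdivlMr// mul1r.
rewrite expr1n subrr mulr0 sqrtr0 ler0_sqrtr//.
by rewrite subr_le0 !expr2 ler_pM ?ltW.
Qed.

Let th_ge0 k : 0 <= th k.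
Proof.
have h := sN1 k.
have [|//] := leP 0 (th k) => //.
move=> h'; have : sin (th k) < 0.
  rewrite -[th k]opprK sinN oppr_lt0 sin_gt0_pi// oppr_gt0 h'/=.
  have := asin_geNpi2 h; rewrite -/(th k); have := pi_gt0 R; lra.
by rewrite sinE; have := s01 k; lra.
Qed.

Let th_le k : th k <= th k.+1.
Proof.
have sle : s k <= s k.+1.
  by rewrite /s le_min2// ler_pM2r ?invr_gt0// ler_nat.
rewrite leNgt; apply/negP => h.
have : sin (th k.+1) < sin (th k).
  have := @ltr_sin R; move=> H; rewrite H//.
    by rewrite in_itv/= asin_lepi2 ?asin_geNpi2.
  by rewrite in_itv/= asin_lepi2 ?asin_geNpi2.
by rewrite !sinE; lra.
Qed.

Let A0 : A 0 = 0.
Proof.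
rewrite /A; have := cosE 0; have := sinE 0; rewrite /th /s mul0r minEle ler01 => -> _.
by rewrite -{1}sin0 sinK ?mul0r ?addr0 ?mulr0// in_itv/=; have := pi_ge0 R; lra.
Qed.

Let A_step k : half_chord k.+1 <= A k.+1 - A k <= half_chord k.
Proof.
have hb : th k.+1 <= pi / 2 by rewrite asin_lepi2.
have /andP[h1 h2] := sector_segment_bounds (th_ge0 k) (th_le k) hb.
have t20 : 0 < t ^+ 2 by rewrite exprn_gt0.
have -> : A k.+1 - A k = t ^+ 2 * (2^-1 * (th k.+1 + sin (th k.+1) * cos (th k.+1))
   - 2^-1 * (th k + sin (th k) * cos (th k))) by rewrite /A mulrBr.
have tk (x : R) : t * (x / t) = x by rewrite mulrC divfK ?gt_eqF.
apply/andP; split; last first.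
  apply: (@le_trans _ _ (t ^+ 2 * (cos (th k) * (sin (th k.+1) - sin (th k))))).
    by rewrite ler_pM2l.
  rewrite !sinE -cosE.
  have : t * (s k.+1 - s k) <= 1.
    rewrite /s; case: (leP (k.+1%:R / t) 1); case: (leP (k%:R / t) 1) => h3 h4.
    - by rewrite mulrBr !tk lerBlDl natr1.
    - have : (k%:R / t) <= (k.+1%:R / t) by rewrite ler_pM2r ?invr_gt0// ler_nat.
      by lra.
    - rewrite mulrBr mulr1 tk lerBlDl natr1.
      by move: h4; rewrite ltr_pdivlMr// mul1r => /ltW.
    - by rewrite subrr mulr0 ler01.
  have c0 : 0 <= cos (th k).
    apply: cos_ge0_pihalf; have := th_ge0 k; have := th_le k; have := pi_ge0 R; lra.
  move=> h; have -> : t ^+ 2 * (cos (th k) * (s k.+1 - s k)) =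
    (t * cos (th k)) * (t * (s k.+1 - s k)) by ring.
  by rewrite -[leRHS]mulr1 ler_wpM2l// mulr_ge0// ltW.
apply: (@le_trans _ _ (t ^+ 2 * (cos (th k.+1) * (sin (th k.+1) - sin (th k))))); last first.
  by rewrite ler_pM2l.
rewrite !sinE -cosE.
have -> : t ^+ 2 * (cos (th k.+1) * (s k.+1 - s k)) =
    (t * cos (th k.+1)) * (t * (s k.+1 - s k)) by ring.
have [h|h] := leP (k.+1%:R / t) 1.
  have -> : t * (s k.+1 - s k) = 1; last by rewrite mulr1.
  have h3 : k%:R / t <= 1.
    by apply: le_trans h; rewrite ler_pM2r ?invr_gt0// ler_nat.
  by rewrite /s (min_idPl h) (min_idPl h3) mulrBr !tk -natr1 addrC addKr.
by rewrite cos_asin ?sN1// /s (min_idPr (ltW h)) expr1n subrr sqrtr0 mulr0 mul0r.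
Qed.

Let A_end L : t <= L%:R -> A L = pi * t ^+ 2 / 4.
Proof.
move=> tL; have E : s L = 1.
  by rewrite /s; apply/min_idPr; rewrite ler_pdivlMr// mul1r.
have E2 : th L = pi / 2.
  rewrite /th E -[X in asin X](sin_pihalf R) sinK// in_itv/= lexx andbT.
  by have := pi_ge0 R; lra.
by rewrite /A E2 cos_pihalf mulr0 addr0; field.
Qed.

Let A_homo k l : (k <= l)%N -> A k <= A l.
Proof.
move/subnKC <-; elim: (l - k)%N => [|n IH]; first by rewrite addn0.
apply: le_trans IH _; rewrite addnS.
have /andP[h _] := A_step (k + n); rewrite -subr_ge0.
by apply: le_trans h; rewrite sqrtr_ge0.
Qed.

Let A_sum L : \sum_(0 <= k < L) (A k.+1 - A k) = A L.
Proof. by rewrite telescope_sumr// A0 subr0. Qed.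

Lemma sum_half_chord_le L : \sum_(1 <= k < L) half_chord k <= pi * t ^+ 2 / 4.
Proof.
case: L => [|L].
  by rewrite big_geq// divr_ge0// mulr_ge0 ?pi_ge0// sqr_ge0.
apply: (@le_trans _ _ (A L)).
  rewrite big_add1/= -A_sum.
  by apply: ler_sum => k _; case/andP: (A_step k).
rewrite -(A_end (L := maxn L (Num.bound t))).
  by apply: A_homo; exact: leq_maxl.
apply: le_trans (ltW (archi_boundP (ltW t0))) _.
by rewrite ler_nat leq_maxr.
Qed.

Lemma sum_half_chord_ge L : t <= L%:R -> pi * t ^+ 2 / 4 <= \sum_(0 <= k < L) half_chord k.
Proof.
move=> /A_end <-; rewrite -A_sum.
by apply: ler_sum => k _; case/andP: (A_step k).
Qed.

End HalfChords.


Section LatticeDisc.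
Variable R : realType.

Definition gap (a p : nat) : nat := (a - p + (p - a))%N.

Lemma sum_gap (G p : nat) (psi : nat -> R) : (p < G)%N ->
  \sum_(a < G) psi (gap a p) =
  psi 0%N + \sum_(1 <= k < p.+1) psi k + \sum_(1 <= k < G - p) psi k.
Proof.
move=> pG; rewrite -(big_mkord xpredT (fun a => psi (gap a p))).
rewrite (big_cat_nat (n := p)) ?(ltnW pG)//=.
have -> : \sum_(0 <= a < p) psi (gap a p) = \sum_(1 <= k < p.+1) psi k.
  rewrite big_nat_rev/= add0n big_add1/=; apply: eq_big_nat => a /andP[_ ap].
  by congr psi; rewrite /gap; lia.
have -> : \sum_(p <= a < G) psi (gap a p) = \sum_(0 <= k < G - p) psi k.
  rewrite -{1}[p]add0n big_addn; apply: eq_big_nat => a _.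
  by congr psi; rewrite /gap; lia.
by rewrite [X in _ + X](@big_ltn _ _ _ 0%N) ?subn_gt0// addrA [psi 0%N + _]addrC.
Qed.

Lemma count_lt_le (h : R) L : 0 <= h -> \sum_(1 <= k < L) (k%:R < h)%R%:R <= h.
Proof.
move=> h0; case: L => [|L]; first by rewrite big_geq.
rewrite big_add1 big_mkord /=.
have := @threshold_count_le R (fun k => k.+1%:R < h) 1 h L ler01 h0.
by rewrite mul1r; apply=> k /ltW; rewrite mulr1.
Qed.

Lemma count_lt_ge (h : R) L : h <= L%:R -> h - 1 <= \sum_(1 <= k < L) (k%:R < h)%R%:R.
Proof.
elim: L h => [|[|L] IH] h hL; first by rewrite big_geq//; lra.
  by rewrite big_geq//; lra.
have [h1|h1] := leP h L.+1%:R.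
  apply: le_trans (IH h h1) _; rewrite [leRHS]big_nat_recr//= lerDl ler0n//.
apply: (@le_trans _ _ (\sum_(1 <= k < L.+2) 1)).
  by rewrite sumr_const_nat; rewrite -natr1 in hL; move: hL; rewrite subn1/=; lra.
rewrite le_eqVlt; apply/orP; left; apply/eqP; apply: eq_big_nat => k /andP[_ kL].
by rewrite (le_lt_trans _ h1)// ler_nat.
Qed.

Definition in_ball {G : nat} (v : 'I_G * 'I_G) (t : R) (w : 'I_G * 'I_G) : bool :=
  eucl_dist (grid_point R v) (grid_point R w) < t.

Definition ball_count {G : nat} (v : 'I_G * 'I_G) (t : R) : nat := #|in_ball v t|.

Lemma sqr_gap (a p : nat) : ((p%:R - a%:R) ^+ 2 : R) = (gap a p)%:R ^+ 2.
Proof.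
rewrite /gap natrD; have [ap|/ltnW pa] := leqP a p.
  have -> : (a - p)%N = 0%N by apply/eqP; rewrite subn_eq0.
  by rewrite natrB// add0r.
have -> : (p - a)%N = 0%N by apply/eqP; rewrite subn_eq0.
by rewrite natrB// addr0 -sqrrN opprB.
Qed.

Lemma grid_dist_lt G (v w : 'I_G * 'I_G) (t : R) : 0 < t ->
  (eucl_dist (grid_point R v) (grid_point R w) < t) =
  ((gap w.2 v.2)%:R < half_chord t (gap w.1 v.1)).
Proof.
move=> t0; rewrite /eucl_dist /grid_point/= !sqr_gap /half_chord.
set a := (gap w.1 v.1)%:R; set b := (gap w.2 v.2)%:R.
have a0 : 0 <= a :> R by rewrite ler0n.
have b0 : 0 <= b :> R by rewrite ler0n.
rewrite -[in LHS](ger0_norm (ltW t0)) -sqrtr_sqr ltr_sqrt ?exprn_gt0//.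
have [h|h] := leP (t ^+ 2 - a ^+ 2) 0.
  rewrite (ler0_sqrtr h); apply/idP/idP => h2; last by lra.
  by have := sqr_ge0 b; lra.
by rewrite -[in RHS](ger0_norm b0) -sqrtr_sqr ltr_sqrt// ltrBrDl.
Qed.

Lemma ball_countE G (v : 'I_G * 'I_G) (t : R) : 0 < t ->
  (ball_count v t)%:R =
  \sum_(a < G) \sum_(b < G) ((gap b v.2)%:R < half_chord t (gap a v.1))%R%:R :> R.
Proof.
move=> t0; rewrite /ball_count -sum1_card natr_sum big_mkcond/=.
rewrite [RHS]pair_big/=; apply: eq_bigr => -[a b] _/=.
by rewrite -topredE/= /in_ball grid_dist_lt//; case: ifP.
Qed.

Lemma half_chord_gt0 (t : R) k : 0 < t -> (0 < half_chord t k) = (k%:R < t).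
Proof.
move=> t0; rewrite /half_chord sqrtr_gt0 subr_gt0.
by rewrite ltr_pXn2r// ?nnegrE ?ler0n ?ltW.
Qed.

Lemma half_chord_le (t : R) k : 0 < t -> half_chord t k <= t.
Proof.
move=> t0; rewrite -[leRHS](ger0_norm (ltW t0)) -sqrtr_sqr ler_sqrt ?exprn_gt0 ?sqr_ge0//.
by rewrite gerBl sqr_ge0.
Qed.

Lemma half_chord0 (t : R) : 0 < t -> half_chord t 0 = t.
Proof. by move=> t0; rewrite /half_chord expr0n/= subr0 sqrtr_sqr gtr0_norm. Qed.

(** Slice the disc into columns: a column at horizontal distance [k] holds at most
    [2 * half_chord t k + 1] cells, and the half-chords on one side add up to at
    most the area of a quarter disc. *)
Lemma ball_count_le G (v : 'I_G * 'I_G) (t : R) : 0 < t ->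
  (ball_count v t)%:R <= pi * t ^+ 2 + 4 * t + 1.
Proof.
move=> t0; rewrite ball_countE//.
pose Psi k : R := (k%:R < t)%R%:R * (2 * half_chord t k + 1).
have Psi_ge k : 0 <= Psi k by rewrite mulr_ge0// addr_ge0// mulr_ge0// sqrtr_ge0.
apply: (@le_trans _ _ (\sum_(a < G) Psi (gap a v.1))).
  apply: ler_sum => a _; rewrite /Psi -half_chord_gt0//.
  set h := half_chord t _.
  have h0 : 0 <= h by exact: sqrtr_ge0.
  rewrite (@sum_gap G v.2 (fun b => (b%:R < h)%R%:R))//.
  have [hp|hn] := ltP 0 h.
    rewrite mul1r (_ : true%:R = 1)//.
    by have := count_lt_le v.2.+1 h0; have := count_lt_le (G - v.2) h0; lra.
  have -> : h = 0 by apply/eqP; rewrite eq_le h0 hn.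
  rewrite mul0r (_ : false%:R = 0)// add0r.
  have := @count_lt_le 0 v.2.+1 (lexx _); have := @count_lt_le 0 (G - v.2) (lexx _); lra.
rewrite sum_gap//.
have P0 : Psi 0%N = 2 * t + 1 by rewrite /Psi t0 mul1r half_chord0.
have PS L : \sum_(1 <= k < L) Psi k <= pi * t ^+ 2 / 2 + t.
  apply: (@le_trans _ _ (\sum_(1 <= k < L) (2 * half_chord t k + (k%:R < t)%R%:R))).
    apply: ler_sum => k _; rewrite /Psi; have := sqrtr_ge0 (t ^+ 2 - k%:R ^+ 2).
    by rewrite -/(half_chord t k); case: (_ < _); rewrite /= ?mulr1n ?mulr0n; lra.
  rewrite big_split/= -mulr_sumr.
  by have := sum_half_chord_le t0 L; have := count_lt_le L (ltW t0); lra.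
by have := PS v.1.+1; have := PS (G - v.1)%N; rewrite P0; lra.
Qed.

Definition interior_cell {G : nat} (r : R) (v : 'I_G * 'I_G) : bool :=
  [&& r <= v.1%:R, r <= v.2%:R, v.1%:R + r <= G%:R & v.2%:R + r <= G%:R].

Lemma ball_count_ge G (v : 'I_G * 'I_G) (t : R) : 0 < t -> interior_cell t v ->
  pi * t ^+ 2 - 4 * t - 1 <= (ball_count v t)%:R.
Proof.
move=> t0 /and4P[v1 v2 v3 v4]; rewrite ball_countE//.
have sz (p : 'I_G) : t <= p%:R -> p%:R + t <= G%:R -> t <= p.+1%:R /\ t <= (G - p)%:R.
  by move=> h1 h2; rewrite -natr1 natrB ?(ltnW (ltn_ord p))//; split; lra.
have [v1a v1b] := sz _ v1 v3; have [v2a v2b] := sz _ v2 v4.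
pose Psi k : R := (k%:R < t)%R%:R * (2 * half_chord t k - 1).
apply: (@le_trans _ _ (\sum_(a < G) Psi (gap a v.1))); last first.
  apply: ler_sum => a _; rewrite /Psi -half_chord_gt0//.
  set h := half_chord t _.
  have ht : h <= t by exact: half_chord_le.
  rewrite (@sum_gap G v.2 (fun b => (b%:R < h)%R%:R))//.
  have [hp|hn] := ltP 0 h.
    rewrite mul1r (_ : true%:R = 1)//.
    have := count_lt_ge (le_trans ht v2a); have := count_lt_ge (le_trans ht v2b); lra.
  by rewrite mul0r !addr_ge0// sumr_ge0.
rewrite sum_gap//.
have P0 : Psi 0%N = 2 * t - 1 by rewrite /Psi t0 mul1r half_chord0.
have PS L : t <= L%:R -> pi * t ^+ 2 / 2 - 3 * t <= \sum_(1 <= k < L) Psi k.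
  move=> tL; apply: (@le_trans _ _ (\sum_(1 <= k < L) (2 * half_chord t k - (k%:R < t)%R%:R))); last first.
    apply: ler_sum => k _; rewrite /Psi -half_chord_gt0//.
    have := sqrtr_ge0 (t ^+ 2 - k%:R ^+ 2).
    by rewrite -/(half_chord t k); case: ltP => h1 h2; rewrite /= ?mulr1n ?mulr0n; lra.
  rewrite sumrB -mulr_sumr.
  have L0 : (0 < L)%N by rewrite -(ltr_nat R); lra.
  have := sum_half_chord_ge t0 tL; rewrite big_ltn// half_chord0//.
  by have := count_lt_le L (ltW t0); lra.
by have := PS _ v1a; have := PS _ v1b; rewrite P0; lra.
Qed.

End LatticeDisc.


(** * A disc misses half of an empty disc *)

Section Lens.
Variable R : realType.

Lemma eucl_dist_lt (x y : R * R) (r : R) : 0 < r ->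
  (eucl_dist x y < r) = ((x.1 - y.1) ^+ 2 + (x.2 - y.2) ^+ 2 < r ^+ 2).
Proof.
by move=> r0; rewrite /eucl_dist -[in LHS](ger0_norm (ltW r0)) -sqrtr_sqr ltr_sqrt ?exprn_gt0.
Qed.

(** If [z] and its reflection in [v] were both at distance less than [r] from [w],
    the parallelogram law would give [dist v w < r].  So the reflection maps the
    intersection into its complement in the ball around [v]. *)
Lemma lens_half G (v w : 'I_G * 'I_G) (s r : R) : 0 < s -> 0 < r ->
  interior_cell s v -> r <= eucl_dist (grid_point R v) (grid_point R w) ->
  (2 * #|[pred z | in_ball w r z
            && in_ball v s z]| <= ball_count v s)%N.
Proof.
move=> s0 r0 /and4P[v1 v2 v3 v4] rvw.
pose refl (z : 'I_G * 'I_G) : 'I_G * 'I_G :=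
  (insubd z.1 (2 * v.1 - z.1)%N, insubd z.2 (2 * v.2 - z.2)%N).
have reflE z : in_ball v s z ->
   ((refl z).1%:R = 2 * v.1%:R - z.1%:R :> R) /\ ((refl z).2%:R = 2 * v.2%:R - z.2%:R :> R).
  rewrite /in_ball eucl_dist_lt//= => h.
  have h1 : (v.1%:R - z.1%:R) ^+ 2 < s ^+ 2.
    by apply: le_lt_trans h; rewrite lerDl sqr_ge0.
  have h2 : (v.2%:R - z.2%:R) ^+ 2 < s ^+ 2.
    by apply: le_lt_trans h; rewrite lerDr sqr_ge0.
  have aux (p q : 'I_G) : s <= p%:R -> p%:R + s <= G%:R -> (p%:R - q%:R) ^+ 2 < s ^+ 2 ->
      (insubd q (2 * p - q)%N : 'I_G)%:R = 2 * p%:R - q%:R :> R.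
    move=> ps pG; rewrite -ltr_sqrt ?exprn_gt0// !sqrtr_sqr (gtr0_norm s0) ltr_norml => /andP[l1 l2].
    have qp : (q <= 2 * p)%N by rewrite -(ler_nat R) natrM; lra.
    rewrite insubdK ?natrB ?natrM//.
    by rewrite -topredE/= -(ltr_nat R) natrB// natrM; lra.
  by split; apply: aux.
set L := [set z | in_ball w r z
            && in_ball v s z]%SET.
have -> : #|[pred z | in_ball w r z
            && in_ball v s z]| = #|L|.
  by apply: eq_card => z; rewrite !inE.
have inj : {in L &, injective refl}.
  move=> z z'; rewrite !inE => /andP[_ /reflE[a1 a2]] /andP[_ /reflE[b1 b2]] e.
  move: a1 a2; rewrite e b1 b2 => a1 a2.
  rewrite [z]surjective_pairing [z']surjective_pairing; congr pair; apply/val_inj/eqP;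
    by rewrite -(eqr_nat R); apply/eqP; lra.
have dis : [disjoint L & refl @: L].
  rewrite -setI_eq0; apply/eqP/setP => z; rewrite !inE; apply/negP => /andP[/andP[h1 h2]].
  move=> /imsetP[z' +]; rewrite inE => /andP[h3 h4] e.
  have [a1 a2] := reflE _ h4.
  have d0 : 0 <= eucl_dist (grid_point R v) (grid_point R w) by exact: sqrtr_ge0.
  have rd : r ^+ 2 <= (v.1%:R - w.1%:R) ^+ 2 + (v.2%:R - w.2%:R) ^+ 2.
    by rewrite leNgt -[X in ~~ X](eucl_dist_lt (grid_point R v) (grid_point R w))// -leNgt.
  move: h1 h3; rewrite /in_ball !eucl_dist_lt//= e a1 a2 => h1 h3.
  have q1 : 0 <= (v.1%:R - z'.1%:R : R) ^+ 2 by exact: sqr_ge0.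
  have q2 : 0 <= (v.2%:R - z'.2%:R : R) ^+ 2 by exact: sqr_ge0.
  nra.
rewrite mul2n -addnn -{2}(card_in_imset inj) -cardsUI.
have -> : L :&: refl @: L = finset.set0 by apply/eqP; rewrite setI_eq0.
rewrite cards0 addn0; apply/subset_leq_card/fintype.subsetP => z; rewrite inE => zL.
change (is_true (in_ball v s z)); move: zL; rewrite !inE.
move=> /orP[/andP[_ ->]//|/imsetP[z' + ->]]; rewrite inE => /andP[_ h].
have [a1 a2] := reflE _ h; move: h; rewrite /in_ball !eucl_dist_lt//= a1 a2.
by congr (_ < _); ring.
Qed.

Lemma crescent_ge G (v w : 'I_G * 'I_G) (s r : R) : 0 < s -> 0 < r ->
  interior_cell s v -> r <= eucl_dist (grid_point R v) (grid_point R w) ->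
  (ball_count w r)%:R - (ball_count v s)%:R / 2 <=
  #|[pred z | in_ball w r z
            && ~~ in_ball v s z]|%:R :> R.
Proof.
move=> s0 r0 iv rvw; have := lens_half s0 r0 iv rvw.
rewrite -(ler_nat R) natrM => h.
have : ball_count w r = (#|[pred z | in_ball w r z
            && in_ball v s z]| +
   #|[pred z | in_ball w r z
            && ~~ in_ball v s z]|)%N.
  rewrite /ball_count -(cardID [pred z | in_ball v s z]).
  by congr addn; apply: eq_card => z; rewrite !inE// andbC.
by move=> /(congr1 (fun k => k%:R : R)); rewrite natrD => ->; lra.
Qed.
End Lens.

(** * Means over independent uniform cells *)

Section Occupancy.
Variables (R : realType) (V : finType) (n : nat).
Hypothesis V0 : (0 < #|V|)%N.

Let mu : R := #|V|%:R^-1.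

Definition mean (phi : {ffun 'I_n -> V} -> R) : R := \sum_f mu ^+ n * phi f.

Lemma mean_prod (F : 'I_n -> V -> R) :
  mean (fun f => \prod_l F l (f l)) = \prod_l (mu * \sum_z F l z).
Proof.
rewrite big_split/= prodr_const card_ord bigA_distr_bigA/= mulr_sumr.
by apply: eq_bigr.
Qed.

Lemma mean_sum (I : Type) (r : seq I) (P : pred I) phi :
  mean (fun f => \sum_(i <- r | P i) phi i f) = \sum_(i <- r | P i) mean (phi i).
Proof.
rewrite /mean exchange_big/=; apply: eq_bigr => f _; rewrite mulr_sumr//.
Qed.

Lemma mean_le phi psi : (forall f, phi f <= psi f) -> mean phi <= mean psi.
Proof.
move=> h; apply: ler_sum => f _; rewrite ler_wpM2l//.
by rewrite exprn_ge0// invr_ge0.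
Qed.

Lemma meanD phi psi : mean (fun f => phi f + psi f) = mean phi + mean psi.
Proof. by rewrite /mean -big_split/=; apply: eq_bigr => f _; rewrite mulrDr. Qed.

Lemma meanZ c phi : mean (fun f => c * phi f) = c * mean phi.
Proof. by rewrite /mean mulr_sumr; apply: eq_bigr => f _; rewrite mulrCA. Qed.

Lemma eq_mean phi psi : phi =1 psi -> mean phi = mean psi.
Proof. by move=> e; apply: eq_bigr => f _; rewrite e. Qed.

Let prob (A : pred V) : R := mu * #|A|%:R.

(** The probability that, among [N] independent trials, none has an outcome of
    probability [a] and at most one has a disjoint outcome of probability [c]. *)
Definition at_most_one_weight (N : nat) (a c : R) : R :=
  (1 - a - c) ^+ N + N%:R * (c * (1 - a - c) ^+ N.-1).

(** Both sides are 0 or 1: either no point falls in [C], or exactly one does, and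
    then [l] is that point.  Products over the points are what [mean_prod] can
    evaluate. *)
Lemma at_most_one_split (S : {set 'I_n}) (A C : pred V) (f : 'I_n -> V) :
  ([forall l, (l \notin S) ==> ~~ A (f l)]
    && (#|[pred l | (l \notin S) && C (f l)]| <= 1)%N)%:R =
  \prod_(l in ~: S) (~~ A (f l) && ~~ C (f l))%:R +
  \sum_(l in ~: S) (C (f l) && ~~ A (f l))%:R *
     \prod_(l' in ~: S :\ l) (~~ A (f l') && ~~ C (f l'))%:R :> R.
Proof.
have prodE (B : {set 'I_n}) (Q : pred 'I_n) :
    \prod_(l in B) (Q l)%:R = [forall l in B, Q l]%:R :> R.
  case: forallP => [h|/forallP].
    by rewrite big1// => l lB; have := h l; rewrite lB/= => ->.
  rewrite negb_forall => /existsP[l]; rewrite negb_imply => /andP[lB nQ].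
  by rewrite (bigD1 l)//= (negbTE nQ) mul0r.
have forallA : [forall l, (l \notin S) ==> ~~ A (f l)] = [forall l in ~: S, ~~ A (f l)].
  by apply: eq_forallb => l; rewrite inE.
rewrite prodE forallA.
under eq_bigr => l _ do rewrite prodE.
have [hA|hA] := boolP [forall l in ~: S, ~~ A (f l)]; last first.
  rewrite andFb; move: hA; rewrite negb_forall => /existsP[l].
  rewrite negb_imply negbK => /andP[lS Al].
  have -> : [forall l in ~: S, ~~ A (f l) && ~~ C (f l)] = false.
    by apply/negP => /forallP/(_ l); rewrite lS Al.
  rewrite big1 ?addr0// => l' l'S.
  have [e|ne] := eqVneq l l'; first by rewrite -e Al andbF mul0r.
  have -> : [forall x in ~: S :\ l', ~~ A (f x) && ~~ C (f x)] = false; last by rewrite mulr0.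
  by apply/negP => /forallP/(_ l); rewrite in_setD1 ne lS Al.
rewrite andTb.
have nA l : l \in ~: S -> A (f l) = false.
  by move=> lS; apply/negbTE; have /forallP/(_ l) := hA; rewrite lS.
set K := [pred l | _].
have [/pred0P K0|/pred0Pn[l0 l0K]] := boolP (pred0b K).
  rewrite eq_card0//= big1 ?addr0.
    have -> // : [forall l in ~: S, ~~ A (f l) && ~~ C (f l)].
    apply/forallP => l; apply/implyP => lS; rewrite nA//=.
    by have := K0 l; rewrite inE/=; rewrite inE in lS; rewrite lS => /= ->.
  move=> l lS; have := K0 l; rewrite inE/=; rewrite inE in lS; rewrite lS => /= ->.
  by rewrite mul0r.
have /andP[l0S Cl0] := l0K.
have l0S' : l0 \in ~: S by rewrite inE.
have -> : [forall l in ~: S, ~~ A (f l) && ~~ C (f l)] = false.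
  by apply/negP => /forallP/(_ l0); rewrite l0S' Cl0 andbF.
rewrite add0r (bigD1 l0)//= Cl0 nA// mul1r [X in _ + X]big1 ?addr0; last first.
  move=> l /andP[lS ll0].
  have -> : [forall x in ~: S :\ l, ~~ A (f x) && ~~ C (f x)] = false; last by rewrite mulr0.
  by apply/negP => /forallP/(_ l0); rewrite in_setD1 eq_sym ll0 l0S' Cl0 andbF.
have l0K' : l0 \in K by rewrite inE l0S Cl0.
congr (_%:R); rewrite (cardD1 l0) l0K' [in LHS]add1n ltnS leqn0; congr nat_of_bool.
apply/eqP/forallP => [h l|h].
  apply/implyP => /setD1P[ll0 lS]; rewrite nA//=.
  apply/negP => Cl; move/eqP: h; apply/negP; rewrite -lt0n.
  apply/card_gt0P; exists l; rewrite !inE ll0 /=; rewrite inE in lS.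
  by rewrite lS Cl.
apply: eq_card0 => l; rewrite !inE; apply/negP => /andP[ll0 /andP[lS Cl]].
by have := h l; rewrite in_setD1 ll0 inE lS /= Cl andbF.
Qed.

Lemma mean_occupancy (S : {set 'I_n}) (y : 'I_n -> V) (A C : pred V) :
  mean (fun f => (\prod_(l in S) (f l == y l)%:R) *
    ([forall l, (l \notin S) ==> ~~ A (f l)]
      && (#|[pred l | (l \notin S) && C (f l)]| <= 1)%N)%:R) =
  mu ^+ #|S| * at_most_one_weight (n - #|S|) (prob A) (prob [pred z | C z && ~~ A z]).
Proof.
pose c := prob [pred z | C z && ~~ A z].
have muV : mu * #|V|%:R = 1 by rewrite mulVf// pnatr_eq0 -lt0n.
have sumB (B : pred V) : mu * \sum_z (B z)%:R = prob B.
  by rewrite /prob -sum1_card natr_sum [in RHS]big_mkcond/=; congr (_ * _);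
    apply: eq_bigr => z _; rewrite -topredE/=; case: (B z).
have freeE : prob [pred z | ~~ A z && ~~ C z] = 1 - prob A - c.
  rewrite /c /prob -[X in _ = X - _ - _]muV -!mulrBr; congr (_ * _).
  have e2 : #|[predC A]| = (#|[pred z | C z && ~~ A z]| + #|[pred z | ~~ A z && ~~ C z]|)%N.
    by rewrite -(cardID C [predC A]); congr addn; apply: eq_card => z; rewrite !inE// andbC.
  have := cardC A; rewrite e2 => /(congr1 (fun k => k%:R : R)); rewrite !natrD => <-.
  ring.
under eq_mean => f do rewrite at_most_one_split mulrDr mulr_sumr.
rewrite meanD mean_sum /at_most_one_weight -/c mulrDr.
have cS : #|~: S| = (n - #|S|)%N by rewrite cardsCs finset.setCK card_ord.
have pt (z0 : V) : mu * \sum_z (z == z0)%:R = mu.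
  rewrite (sumB [pred z | z == z0]) /prob (eq_card (B := pred1 z0)) ?card1 ?mulr1//.
congr (_ + _).
- pose F l z : R := if l \in S then (z == y l)%:R else (~~ A z && ~~ C z)%:R.
  transitivity (mean (fun f => \prod_l F l (f l))).
    rewrite /F; apply: eq_mean => f; rewrite [RHS](bigID (mem S))/=; congr (_ * _).
      by apply: eq_bigr => l ->.
    rewrite [LHS](eq_bigl (fun l => l \notin S)); last by move=> l; rewrite inE.
    by apply: eq_bigr => l /negbTE ->.
  rewrite mean_prod /F (bigID (mem S))/=; congr (_ * _).
    by under eq_bigr => l lS do rewrite lS pt; rewrite prodr_const.
  transitivity (\prod_(l in ~: S) (1 - prob A - c)); last by rewrite prodr_const cS.
  rewrite [RHS](eq_bigl (fun l => l \notin S)); last by move=> l; rewrite inE.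
  apply: eq_bigr => l /negbTE ->; rewrite -freeE -(sumB [pred z | ~~ A z && ~~ C z]).
  by [].
- transitivity (\sum_(l in ~: S) mu ^+ #|S| * (c * (1 - prob A - c) ^+ (n - #|S|).-1)); last first.
    by rewrite sumr_const cS -[in LHS]mulrnAr mulr_natl.
  apply: eq_bigr => l0 l0S; have l0S' : l0 \notin S by move: l0S; rewrite inE.
  pose F l z : R := if l \in S then (z == y l)%:R
     else if l == l0 then (C z && ~~ A z)%:R else (~~ A z && ~~ C z)%:R.
  transitivity (mean (fun f => \prod_l F l (f l))).
    rewrite /F; apply: eq_mean => f; rewrite [RHS](bigID (mem S))/=; congr (_ * _).
      by apply: eq_bigr => l ->.
    rewrite [RHS](bigD1 l0)//= (negbTE l0S') eqxx; congr (_ * _).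
    rewrite [LHS](eq_bigl (fun l => (l \notin S) && (l != l0))); last first.
      by move=> l; rewrite !inE andbC.
    by apply: eq_bigr => l /andP[/negbTE -> /negbTE ->].
  rewrite mean_prod /F (bigID (mem S))/=; congr (_ * _).
    by under eq_bigr => l lS do rewrite lS pt; rewrite prodr_const.
  rewrite (bigD1 l0)//= (negbTE l0S') eqxx (sumB [pred z | C z && ~~ A z]); congr (_ * _).
  transitivity (\prod_(l in ~: S :\ l0) (1 - prob A - c)); last first.
    by rewrite prodr_const -cS (cardsD1 l0 (~: S)) l0S.
  rewrite [RHS](eq_bigl (fun l => (l \notin S) && (l != l0))); last first.
    by move=> l; rewrite !inE andbC.
  apply: eq_bigr => l /andP[/negbTE -> /negbTE ->]; rewrite -freeE.
  by rewrite -(sumB [pred z | ~~ A z && ~~ C z]).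
Qed.

End Occupancy.


Section WeightMonotone.
Variable R : realType.

Lemma exprD_ge (y d : R) m : 0 <= y -> 0 <= d -> y ^+ m.+1 + m.+1%:R * (d * y ^+ m) <= (y + d) ^+ m.+1.
Proof.
move=> y0 d0; elim: m => [|m IH]; first by rewrite !expr1 expr0 mulr1 mul1r.
rewrite [leRHS]exprS; apply: le_trans (_ : (y + d) * (y ^+ m.+1 + m.+1%:R * (d * y ^+ m)) <= _).
  have : 0 <= d * (m.+1%:R * (d * y ^+ m)) by rewrite !mulr_ge0// exprn_ge0.
  rewrite -[in X in X -> _]natr1 -natr1 !exprS -natr1; nra.
by rewrite ler_wpM2l// addr_ge0.
Qed.

(** Enlarging the forbidden regions makes the event rarer.  For [c] this is a form
    of Bernoulli's inequality: [c] also appears with a positive sign. *)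
Lemma at_most_one_weight_le N (a a' c c' : R) : 0 <= a -> a <= a' -> 0 <= c -> c <= c' ->
  a' + c' <= 1 -> at_most_one_weight N a' c' <= at_most_one_weight N a c.
Proof.
move=> a0 aa c0 cc ac1; rewrite /at_most_one_weight.
case: N => [|m]; first by rewrite !expr0 !mul0r.
rewrite /=; set x' := 1 - a' - c'; have x0 : 0 <= x' by rewrite /x'; lra.
have c'0 : 0 <= c' by lra.
have H : x' ^+ m.+1 + m.+1%:R * (c' * x' ^+ m) <=
   (x' + (c' - c)) ^+ m.+1 + m.+1%:R * (c * (x' + (c' - c)) ^+ m).
  case: m => [|m]; first by rewrite !expr1 !expr0; lra.
  set d := c' - c; have d0 : 0 <= d by rewrite /d; lra.
  have := exprD_ge m x0 d0.
  set P := (x' + d) ^+ m.+1; set Q := x' ^+ m => hP.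
  rewrite (exprS (x' + d) m.+1) -/P (exprS x' m.+1) (exprS x' m) -/Q.
  have Q0 : 0 <= Q by rewrite exprn_ge0.
  have c'd : c' = c + d by rewrite /d; lra.
  rewrite exprS -/Q in hP.
  rewrite c'd -!natr1; set k := m%:R; have k0 : 0 <= k by rewrite /k.
  rewrite -natr1 -/k in hP.
  have c2 : 0 <= (k + 1 + 1) * c by apply: mulr_ge0 => //; lra.
  have h2 : (x' + d + (k + 1 + 1) * c) * (x' * Q + (k + 1) * (d * Q)) <=
            (x' + d + (k + 1 + 1) * c) * P.
    by apply: ler_wpM2l => //; lra.
  suff : 0 <= (x' + d + (k + 1 + 1) * c) * (x' * Q + (k + 1) * (d * Q)) -
     (x' * (x' * Q) + (k + 1 + 1) * ((c + d) * (x' * Q))) by lra.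
  have -> : (x' + d + (k + 1 + 1) * c) * (x' * Q + (k + 1) * (d * Q)) -
     (x' * (x' * Q) + (k + 1 + 1) * ((c + d) * (x' * Q))) =
     Q * (k + 1) * d * (d + (k + 1 + 1) * c) by ring.
  by rewrite !mulr_ge0//; lra.
apply: le_trans H _.
have -> : x' + (c' - c) = 1 - a' - c by rewrite /x'; ring.
apply: lerD; first by apply: lerXn2r; rewrite ?nnegrE; lra.
rewrite ler_wpM2l// ler_wpM2l//.
by apply: lerXn2r; rewrite ?nnegrE; lra.
Qed.

Lemma at_most_one_weight_ge0 N (a c : R) : 0 <= c -> a + c <= 1 -> 0 <= at_most_one_weight N a c.
Proof.
move=> c0 ac; have x0 : 0 <= 1 - a - c by lra.
by rewrite addr_ge0 ?exprn_ge0// !mulr_ge0 ?exprn_ge0.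
Qed.

End WeightMonotone.

Section RandomCells.
Variables (R : realType) (G n : nat).
Hypothesis G0 : (0 < G)%N.
Local Notation V := ('I_G * 'I_G)%type.
Local Notation area := (G%:R ^+ 2 : R).

Definition disc_max (t : R) : R := pi * t ^+ 2 + 4 * t + 1.
Definition disc_min (t : R) : R := pi * t ^+ 2 - 4 * t - 1.

Definition cell_dist (f : 'I_n -> V) (i l : 'I_n) : R :=
  eucl_dist (grid_point R (f i)) (grid_point R (f l)).

Lemma cardV : #|{: V}| = (G * G)%N.
Proof. by rewrite card_prod !card_ord. Qed.

Lemma V_gt0 : (0 < #|{: V}|)%N.
Proof. by rewrite cardV muln_gt0 G0. Qed.

Let cardVR : #|{: V}|%:R = area.
Proof. by rewrite cardV natrM expr2. Qed.

Let area0 : 0 < area.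
Proof. by rewrite exprn_gt0// ltr0n. Qed.

Let muV : #|{: V}|%:R^-1 * #|{: V}|%:R = 1 :> R.
Proof. by rewrite cardVR mulVf// gt_eqF. Qed.

(** Conditioning on the cell [y] of one point turns events about distances to it
    into occupancy events for the other points. *)
Lemma mean_isolated_split (phi : {ffun 'I_n -> V} -> R) (i : 'I_n) (Q : V -> bool) (A C : V -> pred V) :
  (forall (f : {ffun 'I_n -> V}) y, f i = y -> Q y ->
     [forall l, (l \notin [set i]) ==> ~~ A y (f l)]
      && (#|[pred l | (l \notin [set i]) && C y (f l)]| <= 1)%N -> phi f = 1) ->
  (forall f, 0 <= phi f) ->
  \sum_(y | Q y) #|{: V}|%:R^-1 * at_most_one_weight n.-1 (#|{: V}|%:R^-1 * #|A y|%:R)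
      (#|{: V}|%:R^-1 * #|[pred z | C y z && ~~ A y z]|%:R) <= mean phi.
Proof.
move=> phi1 phi0.
have E y : #|{: V}|%:R^-1 * at_most_one_weight n.-1 (#|{: V}|%:R^-1 * #|A y|%:R)
      (#|{: V}|%:R^-1 * #|[pred z | C y z && ~~ A y z]|%:R) =
   mean (fun f : {ffun 'I_n -> V} => (\prod_(l in [set i]) (f l == (fun=> y) l)%:R) *
    ([forall l, (l \notin [set i]) ==> ~~ A y (f l)]
      && (#|[pred l | (l \notin [set i]) && C y (f l)]| <= 1)%N)%:R) :> R.
  by rewrite (mean_occupancy R V_gt0 [set i] (fun=> y)) cards1 subn1 expr1.
rewrite (eq_bigr _ (fun y _ => E y)) -mean_sum; apply: mean_le => f.
under eq_bigr => y _ do rewrite big_set1.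
have [Qf|Qf] := boolP (Q (f i)); last first.
  rewrite big1// => y Qy; have [e|ne] := eqVneq (f i) y; last by rewrite mul0r.
  by rewrite e Qy in Qf.
rewrite (bigD1 (f i))//= eqxx mul1r big1 ?addr0; last first.
  by move=> y /andP[_ ne]; rewrite eq_sym (negbTE ne) mul0r.
case: (boolP (_ && _)) => [h|_]; last exact: phi0.
by rewrite (phi1 f (f i)).
Qed.

Lemma near_count_cells (f : {ffun 'I_n -> V}) i (t : R) :
  near_count (cell_dist f) i t = #|[pred l | (l \notin [set i]) && in_ball (f i) t (f l)]|.
Proof. by rewrite /near_count; apply: eq_card => l; rewrite !inE. Qed.

Lemma mean_near_count_le1 (i : 'I_n) (t : R) : 0 < t -> disc_max t <= area ->
  at_most_one_weight n.-1 0 (disc_max t / area) <=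
  mean (fun f : {ffun 'I_n -> V} => (near_count (cell_dist f) i t <= 1)%N%:R).
Proof.
move=> t0 tG.
apply: le_trans (mean_isolated_split (i := i) (Q := xpredT) (A := fun=> pred0)
   (C := fun y => in_ball y t) _ _) => //; last first.
  move=> f y fi _ /andP[_ h]; rewrite near_count_cells fi.
  by rewrite (leq_trans _ h)// (leq_trans _ (leqnn _)).
apply: (@le_trans _ _ (\sum_(y : V) #|{: V}|%:R^-1 * at_most_one_weight n.-1 0 (disc_max t / area))).
  by rewrite sumr_const -[leRHS]mulr_natl mulrA [X in _ <= X * _]mulrC muV mul1r.
apply: ler_sum => y _; rewrite ler_wpM2l ?invr_ge0//.
rewrite card0 mulr0 cardVR; apply: at_most_one_weight_le => //.
- rewrite mulrC ler_pM2r ?invr_gt0//; apply: le_trans (ball_count_le y t0).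
  by rewrite ler_nat /ball_count; apply: eq_leq; apply: eq_card => z; rewrite !inE andbT.
- by rewrite add0r ler_pdivrMr ?mul1r.
Qed.

Lemma mean_near_count_le0 (i : 'I_n) (t : R) : 0 < t -> disc_max t <= area ->
  at_most_one_weight n.-1 (disc_max t / area) 0 <=
  mean (fun f : {ffun 'I_n -> V} => (near_count (cell_dist f) i t <= 0)%N%:R).
Proof.
move=> t0 tG.
apply: le_trans (mean_isolated_split (i := i) (Q := xpredT) (A := fun y => in_ball y t)
   (C := fun=> pred0) _ _) => //; last first.
  move=> f y fi _ /andP[/forallP h _]; rewrite near_count_cells fi leqn0.
  rewrite eq_card0// => l; rewrite !inE; apply/negP => /andP[h1 h2].
  by have := h l; rewrite inE h1 h2.
apply: (@le_trans _ _ (\sum_(y : V) #|{: V}|%:R^-1 * at_most_one_weight n.-1 (disc_max t / area) 0)).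
  by rewrite sumr_const -[leRHS]mulr_natl mulrA [X in _ <= X * _]mulrC muV mul1r.
apply: ler_sum => y _; rewrite ler_wpM2l ?invr_ge0//.
rewrite [X in at_most_one_weight _ _ (_ * X%:R)]eq_card0// mulr0 cardVR; apply: at_most_one_weight_le => //.
- by rewrite mulrC ler_pM2r ?invr_gt0//; exact: ball_count_le.
- by rewrite addr0 ler_pdivrMr ?mul1r.
Qed.

Lemma mean_isolated (j : 'I_n) (t rho : R) : 0 < t -> disc_max t <= area ->
  #|[pred y : V | interior_cell rho y]|%:R / area * at_most_one_weight n.-1 (disc_max t / area) 0 <=
  mean (fun f : {ffun 'I_n -> V} =>
    (interior_cell rho (f j) && (near_count (cell_dist f) j t <= 0)%N)%:R).
Proof.
move=> t0 tG.
apply: le_trans (mean_isolated_split (i := j) (Q := interior_cell rho) (A := fun y => in_ball y t)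
   (C := fun=> pred0) _ _) => //; last first.
  move=> f y fi Qy /andP[/forallP h _]; rewrite fi Qy near_count_cells fi leqn0.
  rewrite eq_card0// => l; rewrite !inE; apply/negP => /andP[h1 h2].
  by have := h l; rewrite inE h1 h2.
apply: (@le_trans _ _ (\sum_(y : V | interior_cell rho y)
    #|{: V}|%:R^-1 * at_most_one_weight n.-1 (disc_max t / area) 0)).
  by rewrite sumr_const -[leRHS]mulr_natl mulrA cardVR.
apply: ler_sum => y _; rewrite ler_wpM2l ?invr_ge0//.
rewrite [X in at_most_one_weight _ _ (_ * X%:R)]eq_card0// mulr0 cardVR; apply: at_most_one_weight_le => //.
- by rewrite mulrC ler_pM2r ?invr_gt0//; exact: ball_count_le.
- by rewrite addr0 ler_pdivrMr ?mul1r.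
Qed.

End RandomCells.


(** * How many points do not pay an isolated point *)

Section NonpayingNeighbours.
Variables (R : realType) (G n : nat).
Hypothesis G0 : (0 < G)%N.
Local Notation V := ('I_G * 'I_G)%type.
Local Notation area := (G%:R ^+ 2 : R).

Lemma interior_cell_near (rho K : R) (y z : V) : interior_cell rho y ->
  eucl_dist (grid_point R y) (grid_point R z) <= K -> interior_cell (rho - K) z.
Proof.
move=> /and4P[y1 y2 y3 y4] dK.
have ab (a b : R) : Num.sqrt (a ^+ 2 + b ^+ 2) <= K -> `|a| <= K /\ `|b| <= K.
  move=> h; split; apply: le_trans h; rewrite -sqrtr_sqr ler_sqrt ?addr_ge0 ?sqr_ge0//.
    by rewrite lerDl sqr_ge0.
  by rewrite lerDr sqr_ge0.
have [] := ab _ _ dK; rewrite /= !ler_norml => /andP[a1 a2] /andP[b1 b2].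
by apply/and4P; split; lra.
Qed.

Lemma interior_cellW (s t : R) (y : V) : s <= t -> interior_cell t y -> interior_cell s y.
Proof. by move=> st /and4P[y1 y2 y3 y4]; apply/and4P; split; lra. Qed.

Lemma radius_bracket (r : nat -> R) (B : nat) (d : R) : r 0%N <= d -> d < r B ->
  exists2 b : 'I_B, r b <= d & d < r b.+1.
Proof.
elim: B => [|B IH] r0 rB; first by move: (le_lt_trans r0 rB); rewrite ltxx.
have [h|h] := leP (r B) d; first by exists ord_max.
by have [b b1 b2] := IH r0 h; exists (widen_ord (leqnSn B) b).
Qed.

Lemma annulus_count_le (y : V) (s t : R) : 0 < s -> s <= t -> interior_cell s y ->
  #|[pred z | ~~ in_ball y s z && in_ball y t z]|%:R <= disc_max t - disc_min s.
Proof.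
move=> s0 st iy.
have := ball_count_ge s0 iy; have := ball_count_le y (lt_le_trans s0 st).
rewrite -/(disc_max t) -/(disc_min s) => h1 h2.
have : ball_count y t = (ball_count y s + #|[pred z | ~~ in_ball y s z && in_ball y t z]|)%N.
  rewrite /ball_count -(cardID (in_ball y s)); congr addn; apply: eq_card => z; rewrite !inE//.
  rewrite /in_ball -!topredE/= andbC; apply: andb_idr => h; exact: lt_le_trans h st.
by move=> /(congr1 (fun k => k%:R : R)); rewrite natrD; lra.
Qed.

Lemma disc_min_le_max (x y : R) : 0 <= x -> x <= y -> disc_min x <= disc_max y.
Proof.
move=> x0 xy; have := pi_ge0 R; rewrite /disc_max /disc_min => h1.
have : pi * x ^+ 2 <= pi * y ^+ 2 by rewrite ler_wpM2l// !expr2 ler_pM.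
lra.
Qed.

(** Given the cell [y] of the isolated point [j] and the cell [z] of [i], the event
    says that the other points avoid the ball around [y] and that at most one of
    them lies in the ball around [z].  The part of the latter ball outside the
    former has at least [disc_min (r b - u) - disc_max S / 2] cells when [z] is in
    the annulus between [r b] and [r b.+1]. *)
Lemma mean_nonpaying (i j : 'I_n) (S u K rho : R) (r : nat -> R) (B : nat) : i != j ->
  0 < S -> 0 <= u -> u < S -> r 0%N = S -> {homo r : a b / (a <= b)%N >-> a <= b} ->
  K < r B -> 2 * K <= rho -> r B <= rho ->
  0 <= disc_min S -> (forall b, (b < B)%N -> 0 <= disc_min (r b - u) - disc_max S / 2) ->
  (forall b, (b < B)%N -> disc_min S + (disc_min (r b - u) - disc_max S / 2) <= area) ->
  mean (fun f : {ffun 'I_n -> V} =>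
    ([&& interior_cell rho (f j), (near_count (cell_dist R f) j S <= 0)%N,
      cell_dist R f i j <= K &
      (near_count (cell_dist R f) i (cell_dist R f i j - u)%R <= 1)%N])%:R) <=
  \sum_(b < B) (disc_max (r b.+1) - disc_min (r b)) / area *
     at_most_one_weight (n - 2) (disc_min S / area)
       ((disc_min (r b - u) - disc_max S / 2) / area).
Proof.
move=> ij S0 u0 uS r0 rmono KrB Krho rBrho mS mr mA.
have area0 : 0 < area by rewrite exprn_gt0// ltr0n.
have cardVR : #|{: V}|%:R = area by rewrite cardV natrM expr2.
pose mu : R := #|{: V}|%:R^-1.
have mu0 : 0 <= mu by rewrite invr_ge0.
have muE : mu = area^-1 by rewrite /mu cardVR.
pose d (y z : V) : R := eucl_dist (grid_point R y) (grid_point R z).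
have dC y z : d y z = d z y by rewrite /d /eucl_dist -[X in X + _]sqrrN -[X in _ + X]sqrrN !opprB.
(* The prescribed cells of the points [j] and [i]. *)
pose Y (y z : V) (l : 'I_n) := if l == j then y else z.
pose P (p : V * V) := [&& interior_cell rho p.1, S <= d p.1 p.2 & d p.1 p.2 <= K].
pose A (p : V * V) : pred V := in_ball p.1 S.
pose C (p : V * V) : pred V := in_ball p.2 (d p.1 p.2 - u).
pose g (p : V * V) (f : {ffun 'I_n -> V}) : R :=
  (\prod_(l in [set i; j]) (f l == Y p.1 p.2 l)%:R) *
    ([forall l, (l \notin [set i; j]) ==> ~~ A p (f l)]
      && (#|[pred l | (l \notin [set i; j]) && C p (f l)]| <= 1)%N)%:R.
have g0 p f : 0 <= g p f by rewrite mulr_ge0// prodr_ge0.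
have c2 : #|[set i; j]| = 2%N by rewrite cards2 ij.
apply: (@le_trans _ _ (mean (fun f => \sum_(p | P p) g p f))).
  apply: mean_le => // f.
  case: (boolP [&& _, _, _ & _]) => [/and4P[h1 h2 h3 h4]|_]; last exact: sumr_ge0.
  move: h2; rewrite leqn0 near_count_cells => /eqP/card0_eq h2.
  have far l : l != j -> ~~ in_ball (f j) S (f l).
    move=> lj; apply/negP => h; have := h2 l.
    by rewrite !inE lj h.
  have Pf : P (f j, f i).
    rewrite /P/= h1 dC h3 andbT/=; have := far i ij.
    by rewrite /in_ball -leNgt dC.
  rewrite (bigD1 (f j, f i))//= -[leLHS]addr0; apply: lerD; last exact: sumr_ge0.
  rewrite /g big1 ?mul1r; last first.
    move=> l; rewrite !inE /Y/= => /orP[/eqP ->|/eqP ->]; first by rewrite (negbTE ij) eqxx.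
    by rewrite !eqxx.
  have -> : [forall l, (l \notin [set i; j]) ==> ~~ A (f j, f i) (f l)].
    by apply/forallP => l; rewrite !inE negb_or; apply/implyP => /andP[_ lj]; exact: far.
  rewrite andTb (_ : (_ <= 1)%N)// (leq_trans _ h4)// near_count_cells subset_leq_card//.
  apply/fintype.subsetP => l; rewrite !inE negb_or => /andP[/andP[-> _]].
  by rewrite /C/= -[d (f j) _]dC.
rewrite mean_sum.
have Eg p : mean (g p) = mu ^+ 2 * at_most_one_weight (n - 2) (mu * #|A p|%:R)
    (mu * #|[pred z | C p z && ~~ A p z]|%:R).
  by rewrite /g (mean_occupancy R (V_gt0 G0)) c2.
rewrite (eq_bigr _ (fun p _ => Eg p)).
pose W (b : nat) := at_most_one_weight (n - 2) (disc_min S / area)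
       ((disc_min (r b - u) - disc_max S / 2) / area).
pose ring_ (b : nat) (p : V * V) := ~~ in_ball p.1 (r b) p.2 && in_ball p.1 (r b.+1) p.2.
have le1 p : mu * #|A p|%:R + mu * #|[pred z | C p z && ~~ A p z]|%:R <= 1.
  rewrite -mulrDr muE mulrC ler_pdivrMr// mul1r -cardVR -natrD ler_nat.
  rewrite -cardUI (eq_card0 (A := [predI _ & _])) ?addn0; first exact: max_card.
  by move=> z; rewrite !inE -topredE/=; case: (A p z); rewrite ?andbF.
have rS b : S <= r b by rewrite -r0 rmono.
have key p (b : 'I_B) : P p -> r b <= d p.1 p.2 ->
   [/\ 0 <= disc_min S / area, disc_min S / area <= mu * #|A p|%:R,
     0 <= (disc_min (r b - u) - disc_max S / 2) / area &
     (disc_min (r b - u) - disc_max S / 2) / area <= mu * #|[pred z | C p z && ~~ A p z]|%:R].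
  move=> /and3P[p1 p2 p3] rb; rewrite muE ![area^-1 * _]mulrC.
  have rSb := rS b.
  have Srho : S <= rho by apply: le_trans rBrho; exact: rS.
  have iS : interior_cell S p.1 by exact: interior_cellW p1.
  have ru0 : 0 < r b - u by lra.
  have i2 : interior_cell (r b - u) p.2.
    have := interior_cell_near p1 p3; apply: interior_cellW; lra.
  split; rewrite ?ler_pM2r ?invr_gt0 ?divr_ge0// ?mr ?(ltW area0)//.
    exact: ball_count_ge.
  have h1 := @crescent_ge R G p.1 p.2 S (r b - u) S0 ru0 iS.
  have h2 : r b - u <= d p.1 p.2 by lra.
  have h3 := h1 h2; have h4 := ball_count_ge ru0 i2; have h5 := ball_count_le p.1 S0.
  apply: le_trans (_ : _ <= #|[pred z | in_ball p.2 (r b - u) z && ~~ in_ball p.1 S z]|%:R) _.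
    by move: h3 h4 h5; rewrite -/(disc_min _) -/(disc_max _); lra.
  rewrite ler_nat subset_leq_card//; apply/fintype.subsetP => z; rewrite !inE => /andP[q1 q2].
  rewrite /A q2 andbT /C /in_ball; apply: lt_le_trans q1 _; lra.
have W0 (b : 'I_B) : 0 <= W b.
  apply: at_most_one_weight_ge0; first by rewrite divr_ge0 ?mr// ltW.
  by rewrite -mulrDl ler_pdivrMr ?mul1r ?mA.
apply: (@le_trans _ _ (\sum_(p | P p) mu ^+ 2 * \sum_(b < B) (ring_ b p)%:R * W b)).
  apply: ler_sum => p Pp; rewrite ler_wpM2l ?exprn_ge0//.
  have /and3P[p1 p2 p3] := Pp.
  have [b b1 b2] : exists2 b : 'I_B, r b <= d p.1 p.2 & d p.1 p.2 < r b.+1.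
    by apply: radius_bracket; rewrite ?r0//; exact: le_lt_trans KrB.
  have [k1 k2 k3 k4] := key p b Pp b1.
  rewrite (bigD1 b)//= -[leLHS]addr0; apply: lerD; last first.
    by apply: sumr_ge0 => b' _; rewrite mulr_ge0.
  by rewrite /ring_ {1 2}/in_ball -leNgt b1 b2 mul1r; exact: at_most_one_weight_le.
under eq_bigr => p _ do rewrite mulr_sumr.
rewrite exchange_big/=; apply: ler_sum => b _; rewrite -/(W b).
under eq_bigr => p _ do rewrite mulrA.
rewrite -mulr_suml ler_wpM2r//.
have pairE : \sum_(p | P p) mu ^+ 2 * (ring_ b p)%:R <=
   \sum_(y | interior_cell rho y) mu * \sum_z mu * (ring_ b (y, z))%:R.
  rewrite (eq_bigr (fun y => \sum_z mu ^+ 2 * (ring_ b (y, z))%:R)); last first.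
    by move=> y _; rewrite mulr_sumr; apply: eq_bigr => z _; rewrite expr2 mulrA.
  rewrite pair_big/= [leRHS]big_mkcond [leLHS]big_mkcond/=; apply: ler_sum => -[y z] _/=.
  rewrite /P/=; case: (interior_cell rho y) => //=; rewrite ?andbT.
  by case: ifP => // _; rewrite mulr_ge0// exprn_ge0.
apply: le_trans pairE _.
apply: (@le_trans _ _ (\sum_(y : V | interior_cell rho y) mu * ((disc_max (r b.+1) - disc_min (r b)) / area))).
  apply: ler_sum => y iy; rewrite ler_wpM2l// -mulr_sumr muE mulrC ler_pM2r ?invr_gt0//.
  apply: le_trans (annulus_count_le (y := y) (s := r b) (t := r b.+1) _ _ _); last 3 first.
  - exact: lt_le_trans S0 (rS b).
  - exact: rmono.
  - by apply: interior_cellW iy; apply: le_trans rBrho; apply: rmono; exact: ltnW.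
  rewrite -sum1_card natr_sum [leRHS]big_mkcond/=; apply: ler_sum => z _.
  by rewrite -topredE/= /ring_/=; case: (_ && _).
have a0 : 0 <= disc_max (r b.+1) - disc_min (r b).
  rewrite subr_ge0 disc_min_le_max ?rmono//; exact: le_trans (ltW S0) (rS b).
rewrite -mulr_suml -[leRHS]mul1r ler_wpM2r//; first by rewrite divr_ge0// ltW.
rewrite sumr_const -[leLHS]mulr_natl muE ler_pdivrMr// mul1r -cardVR ler_nat; exact: max_card.
Qed.

End NonpayingNeighbours.


Local Open Scope classical_set_scope.
Local Open Scope ring_scope.


(** * Poisson limits *)

Section PoissonLimit.
Variable R : realType.

Lemma cvg_sum_seq (n : nat) (u : 'I_n -> nat -> R) (l : 'I_n -> R) :
  (forall i, u i @ \oo --> l i) ->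
  (fun m => \sum_(i < n) u i m) @ \oo --> \sum_(i < n) l i.
Proof.
elim: n u l => [|n IH] u l h.
  under eq_fun do rewrite big_ord0; rewrite big_ord0; exact: cvg_cst.
under eq_fun do rewrite big_ord_recr; rewrite big_ord_recr/=.
by apply: cvgD; [exact: IH|exact: h].
Qed.

Let v (m : nat) : R := m.+1%:R^-1.

Let cvg_v : v @ \oo --> (0 : R).
Proof. exact: cvg_harmonic. Qed.

Lemma cvg_disc_max (t : R) :
  (fun m => disc_max (t * m.+1%:R) / m.+1%:R ^+ 2) @ \oo --> pi * t ^+ 2.
Proof.
have -> : (fun m => disc_max (t * m.+1%:R) / m.+1%:R ^+ 2) =
    (fun m => pi * t ^+ 2 + 4 * t * v m + v m * v m).
  by apply/funext => m; rewrite /disc_max /v; field.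
rewrite -[X in _ --> X]addr0 -[X in _ --> X + _]addr0.
apply: cvgD; last by rewrite -[X in _ --> X](mulr0 0); exact: cvgM.
apply: cvgD; first exact: cvg_cst.
by rewrite -[X in _ --> X](mulr0 (4 * t)); apply: cvgM => //; exact: cvg_cst.
Qed.

Lemma cvg_disc_min (t : R) :
  (fun m => disc_min (t * m.+1%:R) / m.+1%:R ^+ 2) @ \oo --> pi * t ^+ 2.
Proof.
have -> : (fun m => disc_min (t * m.+1%:R) / m.+1%:R ^+ 2) =
    (fun m => pi * t ^+ 2 - 4 * t * v m - v m * v m).
  by apply/funext => m; rewrite /disc_min /v; field.
rewrite -[X in _ --> X]subr0 -[X in _ --> X - _]subr0.
apply: cvgB; last by rewrite -[X in _ --> X](mulr0 0); exact: cvgM.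
apply: cvgB; first exact: cvg_cst.
by rewrite -[X in _ --> X](mulr0 (4 * t)); apply: cvgM => //; exact: cvg_cst.
Qed.

Let cvg_ratio (k : nat) : (fun m => (m.+1 ^ 2 - k)%N%:R * v m ^+ 2) @ \oo --> (1 : R).
Proof.
have h : (fun m => 1 - k%:R * (v m * v m)) @ \oo --> (1 : R).
  rewrite -[X in _ --> X]subr0; apply: cvgB; first exact: cvg_cst.
  rewrite -[X in _ --> X](mulr0 k%:R); apply: cvgM; first exact: cvg_cst.
  by rewrite -[X in _ --> X](mulr0 0); exact: cvgM.
apply: cvg_trans h; apply: near_eq_cvg; near=> m.
have mk : (k <= m.+1 ^ 2)%N.
  have : (k <= m)%N by near: m; exact: nbhs_infty_ge.
  by move=> /leq_trans; apply; rewrite expnS expn1; nia.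
by rewrite natrB// natrX /v; field.
Unshelve. all: end_near. Qed.

(** Squeeze between two exponentials, from [1 - y <= exp (- y)] and
    [1 - y >= exp (- y / (1 - y))]. *)
Lemma cvg_void_prob (k : nat) (x : nat -> R) (l : R) : x @ \oo --> l ->
  (fun m => (1 - x m / m.+1%:R ^+ 2) ^+ (m.+1 ^ 2 - k)) @ \oo --> expR (- l).
Proof.
move=> xl.
pose N m : nat := (m.+1 ^ 2 - k)%N.
pose y m := x m * (v m * v m).
have yE m : x m / m.+1%:R ^+ 2 = y m by rewrite /y /v -invfM expr2.
have y0 : y @ \oo --> (0 : R).
  rewrite -[X in _ --> X](mulr0 l); apply: cvgM => //.
  by rewrite -[X in _ --> X](mulr0 0); exact: cvgM.
have Ny : (fun m => (N m)%:R * y m) @ \oo --> l.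
  have -> : (fun m => (N m)%:R * y m) = (fun m => ((N m)%:R * v m ^+ 2) * x m).
    by apply/funext => m; rewrite /y; ring.
  by rewrite -[X in _ --> X]mul1r; apply: cvgM => //; exact: cvg_ratio.
have Nyy : (fun m => ((N m)%:R * y m) * (1 - y m)^-1) @ \oo --> l.
  rewrite -[X in _ --> X]mulr1; apply: cvgM => //.
  rewrite -[X in _ --> X]invr1; apply: cvgV; first exact: oner_neq0.
  by rewrite -[X in _ --> X]subr0; apply: cvgB => //; exact: cvg_cst.
have e1 : (fun m => expR (- ((N m)%:R * y m))) @ \oo --> expR (- l).
  by apply: continuous_cvg; [exact: continuous_expR|exact: cvgN].
have e2 : (fun m => expR (- (((N m)%:R * y m) * (1 - y m)^-1))) @ \oo --> expR (- l).
  by apply: continuous_cvg; [exact: continuous_expR|exact: cvgN].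
apply: squeeze_cvgr e2 e1; near=> m.
rewrite yE.
have y1 : y m < 1 by near: m; apply: (cvgr_lt _ y0).
have p : 0 < 1 - y m by rewrite subr_gt0.
apply/andP; split.
  have -> : - ((N m)%:R * y m / (1 - y m)) = (N m)%:R * - (y m / (1 - y m)) by ring.
  rewrite expRM_natl; apply: lerXn2r; rewrite ?nnegrE ?expR_ge0 ?(ltW p)//.
  rewrite expRN -[leRHS]invrK lef_pV2 ?posrE ?expR_gt0 ?invr_gt0//.
  apply: le_trans (expR_ge1Dx _).
  by rewrite le_eqVlt; apply/orP; left; apply/eqP; field; rewrite gt_eqF.
have -> : - ((N m)%:R * y m) = (N m)%:R * - y m by ring.
rewrite expRM_natl; apply: lerXn2r; rewrite ?nnegrE ?expR_ge0 ?(ltW p)//.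
exact: expR_ge1Dx.
Unshelve. all: end_near. Qed.

Lemma cvg_at_most_one_weight (k : nat) (a c : nat -> R) (la lc : R) :
  a @ \oo --> la -> c @ \oo --> lc ->
  (fun m => at_most_one_weight (m.+1 ^ 2 - k) (a m / m.+1%:R ^+ 2) (c m / m.+1%:R ^+ 2))
    @ \oo --> expR (- (la + lc)) * (1 + lc).
Proof.
move=> al cl.
have acl : (fun m => a m + c m) @ \oo --> la + lc by exact: cvgD.
have -> : (fun m => at_most_one_weight (m.+1 ^ 2 - k) (a m / m.+1%:R ^+ 2) (c m / m.+1%:R ^+ 2)) =
   (fun m => (1 - (a m + c m) / m.+1%:R ^+ 2) ^+ (m.+1 ^ 2 - k) +
      (((m.+1 ^ 2 - k)%N%:R * v m ^+ 2) * c m) *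
      (1 - (a m + c m) / m.+1%:R ^+ 2) ^+ (m.+1 ^ 2 - k.+1)).
  apply/funext => m; rewrite /at_most_one_weight subnS mulrDl opprD addrA; congr (_ + _).
  by set P := _ ^+ _.-1; rewrite /v; field.
rewrite mulrDr mulr1; apply: cvgD; first exact: cvg_void_prob.
rewrite [X in _ --> X]mulrC; apply: cvgM; last exact: cvg_void_prob.
by rewrite -[X in _ --> X]mul1r; apply: cvgM => //; exact: cvg_ratio.
Qed.

Lemma card_interior_ge (G : nat) (rho : R) : 0 <= rho -> 2 * rho + 2 <= G%:R ->
  (G%:R - 2 * rho - 2) ^+ 2 <= #|[pred y : 'I_G * 'I_G | interior_cell rho y]|%:R.
Proof.
move=> rho0 rG.
pose I := [pred a : 'I_G | (rho <= a%:R) && (a%:R + rho <= G%:R)].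
have -> : #|[pred y : 'I_G * 'I_G | interior_cell rho y]| = (#|I| * #|I|)%N.
  rewrite -cardX; apply: eq_card => -[a b]; rewrite !inE /interior_cell/=.
  by case: (rho <= a%:R); case: (rho <= b%:R); rewrite ?andbF.
rewrite natrM -expr2; apply: lerXn2r; rewrite ?nnegrE; [lra|exact: ler0n|].
have lt_count : \sum_(a < G) (a%:R < rho)%R%:R <= rho + 1.
  rewrite -(big_mkord xpredT (fun a => (a%:R < rho)%R%:R)).
  case: {rG I} G => [|G']; first by rewrite big_geq//; lra.
  rewrite big_ltn//.
  have := count_lt_le G'.+1 rho0; case: ltP => _ /=; lra.
have gt_count : \sum_(a < G) (G%:R < a%:R + rho)%R%:R <= rho + 1.
  apply: le_trans lt_count; rewrite (reindex_inj rev_ord_inj)/=; apply: ler_sum => a _.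
  have e : (G - a.+1)%N%:R = G%:R - a%:R - 1 :> R.
    by rewrite natrB// -natr1; ring.
  rewrite e; case: ltP => h1; case: ltP => h2 //=; lra.
have : \sum_(a < G) (1 : R) <= \sum_(a < G) ((I a)%:R + (a%:R < rho)%R%:R + (G%:R < a%:R + rho)%R%:R).
  apply: ler_sum => a _; rewrite /I/= leNgt [a%:R + rho <= _]leNgt.
  by case: (ltP a%:R rho) => _; case: (ltP G%:R (a%:R + rho)) => _ /=; lra.
rewrite !big_split/= sumr_const card_ord -sum1_card natr_sum [in X in _ -> X]big_mkcond/=.
have -> : \sum_(a < G) (if a \in I then 1 else 0) = \sum_(a < G) (I a)%:R :> R.
  by apply: eq_bigr => a _; rewrite inE/=; case: (_ && _).
lra.
Qed.

End PoissonLimit.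


(** * The lower bound for the tour length and the limit of its mean *)

Section Score.
Variables (R : realType) (J T q B : nat) (s u K : R) (r : nat -> R).

(** There are [M ^ 2] points with [M = m.+1], and the side of the square has
   [M ^ 2] cells, so [M] cell sides are one unit of length [1 / sqrt n]. *)
Definition cell_config (m : nat) : finType := {ffun 'I_(m.+1 ^ 2) -> 'I_(m.+1 ^ 2) * 'I_(m.+1 ^ 2)}.

(** The margin keeps the ball around an isolated point, the annuli around it
    and the balls around the points within [K] of it inside the square. *)
Definition margin : R := 2 * K + r B.

Definition isolated_cell (m : nat) (f : cell_config m) (j : 'I_(m.+1 ^ 2)) : bool :=
  interior_cell (margin * m.+1%:R) (f j)
  && (near_count (cell_dist R f) j (s * m.+1%:R)%R <= 0)%N.

(** The left-hand side of [tsp_excess] for the grid points, per point and in units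
    of [1 / sqrt n]; its first part approximates the mean of [D1 + D2], its second
    part collects the payments to the isolated points. *)
Definition score (m : nat) (f : cell_config m) : R :=
  (\sum_i m.+1%:R / J%:R * \sum_(k < T)
      ((near_count (cell_dist R f) i (k.+1%:R * (m.+1%:R / J%:R))%R <= 0)%N%:R
     + (near_count (cell_dist R f) i (k.+1%:R * (m.+1%:R / J%:R))%R <= 1)%N%:R)
  + \sum_(j | isolated_cell f j) (u * m.+1%:R) * \sum_(k < q) (2 - \sum_(i | i != j)
      ((cell_dist R f i j <= K * m.+1%:R)
       && (near_count (cell_dist R f) i (cell_dist R f i j - k.+1%:R * (u * m.+1%:R))%R <= 1)%N)%:R))
  / m.+1%:R ^+ 3.

Definition score_sup : R := 2 * T%:R / J%:R + 2 * q%:R * u.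

Hypotheses (J0 : (0 < J)%N) (u0 : 0 < u).

Let M0 m : 0 < m.+1%:R :> R.
Proof. by rewrite ltr0n. Qed.

Lemma score_le_sup m (f : cell_config m) : score f <= score_sup.
Proof.
rewrite /score ler_pdivrMr ?exprn_gt0//.
have n2 : (m.+1 ^ 2)%N%:R = m.+1%:R ^+ 2 :> R by rewrite natrX.
have -> : score_sup * m.+1%:R ^+ 3 =
   m.+1%:R ^+ 2 * (m.+1%:R / J%:R * (T%:R * 2)) +
   m.+1%:R ^+ 2 * (u * m.+1%:R * (q%:R * 2)).
  by rewrite /score_sup; field; rewrite pnatr_eq0 -lt0n.
apply: lerD.
  rewrite -n2 [leRHS]mulr_natl -[in leRHS](card_ord (m.+1 ^ 2)) -sumr_const; apply: ler_sum => i _.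
  rewrite ler_wpM2l ?divr_ge0// [leRHS]mulr_natl -[in leRHS](card_ord T) -sumr_const.
  by apply: ler_sum => k _; case: (_ <= _)%N; case: (_ <= _)%N => /=; lra.
have um : 0 <= u * m.+1%:R by rewrite mulr_ge0// ltW.
apply: (@le_trans _ _ (\sum_(j | isolated_cell f j) u * m.+1%:R * (q%:R * 2))).
  apply: ler_sum => j _; rewrite ler_wpM2l//.
  rewrite [leRHS]mulr_natl -[in leRHS](card_ord q) -sumr_const.
  apply: ler_sum => k _; rewrite gerBl sumr_ge0//.
rewrite -n2 [leRHS]mulr_natl -[in leRHS](card_ord (m.+1 ^ 2)) -sumr_const.
rewrite big_mkcond/=; apply: ler_sum => j _; case: ifP => // _.
by rewrite mulr_ge0// mulr_ge0.
Qed.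

Lemma tsp_ge_score m (f : cell_config m) (x : 'I_(m.+1 ^ 2) -> R * R) (eta : R) :
  (0 < m)%N -> 0 <= eta -> q%:R * u <= eta * K ->
  (forall i, [/\ (f i).1%:R <= (m.+1 ^ 2)%N%:R * (x i).1 < (f i).1.+1%:R &
                 (f i).2%:R <= (m.+1 ^ 2)%N%:R * (x i).2 < (f i).2.+1%:R]) ->
  score f <= (1 + eta) * 2 * (tsp_length x / m.+1%:R + 2 / m.+1%:R).
Proof.
move=> m0 eta0 qK fx.
have n3 : (2 < m.+1 ^ 2)%N by nia.
have n2 : (m.+1 ^ 2)%N%:R = m.+1%:R ^+ 2 :> R by rewrite natrX.
rewrite /score ler_pdivrMr ?exprn_gt0//.
apply: le_trans (tsp_excess (x := x) (err := 2) (scale := (m.+1 ^ 2)%N%:R) (eta := eta)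
   (isolated_cell f) T n3 _ _ _ _ _ _ _) _ => //.
- by move=> i l; exact: sqrtr_ge0.
- move=> i l; rewrite /cell_dist /eucl_dist.
  by rewrite -[X in X + _]sqrrN -[X in _ + X]sqrrN !opprB.
- move=> i l; apply: grid_dist_le; first by rewrite expn_gt0.
  by have [a1 a2] := fx i; have [b1 b2] := fx l; split.
- by rewrite mulr_ge0// ltW.
- by rewrite !mulrA ler_pM2r.
- rewrite le_eqVlt; apply/orP; left; apply/eqP; rewrite n2; field.
  by rewrite gt_eqF.
Qed.

End Score.


Section MeanScore.
Variables (R : realType) (J T q B : nat) (s u K : R) (r : nat -> R).
Hypotheses (J0 : (0 < J)%N) (u0 : 0 < u) (s0 : 0 < s) (K0 : 0 < K).
Hypotheses (qus : q%:R * u < s) (r0 : r 0%N = s).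
Hypotheses (rmono : {homo r : a b / (a <= b)%N >-> a <= b}) (KrB : K < r B).
(* [sep] says that even the smallest disc considered around a neighbour is larger
   than half of the empty disc. *)
Hypothesis sep : s ^+ 2 / 2 < (s - q%:R * u) ^+ 2.

Let area (m : nat) : R := (m.+1 ^ 2)%N%:R ^+ 2.
Let t (k : nat) : R := k.+1%:R / J%:R.
Let U (k : nat) : R := k.+1%:R * u.
Let crescent (m k b : nat) : R :=
  disc_min ((r b - U k) * m.+1%:R) - disc_max (s * m.+1%:R) / 2.
Let inner (m : nat) : R :=
  ((m.+1 ^ 2)%N%:R - 2 * (margin B K r * m.+1%:R) - 2) ^+ 2 / area m.

Let score_floor (m : nat) : R :=
  J%:R^-1 * \sum_(k < T)
    (at_most_one_weight (m.+1 ^ 2 - 1) (disc_max (t k * m.+1%:R) / area m) 0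
   + at_most_one_weight (m.+1 ^ 2 - 1) 0 (disc_max (t k * m.+1%:R) / area m))
  + u * \sum_(k < q) (2 * (inner m *
        at_most_one_weight (m.+1 ^ 2 - 1) (disc_max (s * m.+1%:R) / area m) 0)
    - \sum_(b < B) (disc_max (r b.+1 * m.+1%:R) - disc_min (r b * m.+1%:R)) / m.+1%:R ^+ 2 *
        at_most_one_weight (m.+1 ^ 2 - 2) (disc_min (s * m.+1%:R) / area m)
          (crescent m k b / area m)).

Definition score_limit : R :=
  J%:R^-1 * \sum_(k < T)
    (expR (- (pi * (k.+1%:R / J%:R) ^+ 2 + 0)) * (1 + 0)
   + expR (- (0 + pi * (k.+1%:R / J%:R) ^+ 2)) * (1 + pi * (k.+1%:R / J%:R) ^+ 2))
  + u * \sum_(k < q) (2 * (1 * (expR (- (pi * s ^+ 2 + 0)) * (1 + 0)))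
    - \sum_(b < B) (pi * r b.+1 ^+ 2 - pi * r b ^+ 2) *
       (expR (- (pi * s ^+ 2 + (pi * (r b - k.+1%:R * u) ^+ 2 - pi * s ^+ 2 / 2))) *
         (1 + (pi * (r b - k.+1%:R * u) ^+ 2 - pi * s ^+ 2 / 2)))).

Let M0 m : 0 < m.+1%:R :> R.
Proof. by rewrite ltr0n. Qed.

Let areaE m : area m = m.+1%:R ^+ 2 * m.+1%:R ^+ 2.
Proof. by rewrite /area natrX -exprM -exprD. Qed.

Let G0 m : (0 < m.+1 ^ 2)%N.
Proof. by rewrite expn_gt0. Qed.

Let area0 m : 0 < area m.
Proof. by rewrite areaE mulr_gt0 ?exprn_gt0. Qed.

Let rs b : s <= r b.
Proof. by rewrite -r0 rmono. Qed.

Let Uq (k : 'I_q) : U k <= q%:R * u.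
Proof. by rewrite /U ler_pM2r// ler_nat. Qed.

Let margin0 : 0 <= margin B K r.
Proof. by rewrite /margin; have h := rs B; have h2 := s0; have h3 := K0; lra. Qed.

Let mean_score_ge (m : nat) :
  (forall k : 'I_T, disc_max (t k * m.+1%:R) <= area m) ->
  disc_max (s * m.+1%:R) <= area m -> 0 <= disc_min (s * m.+1%:R) ->
  (forall (k : 'I_q) (b : 'I_B), 0 <= crescent m k b) ->
  (forall (k : 'I_q) (b : 'I_B), disc_min (s * m.+1%:R) + crescent m k b <= area m) ->
  2 * (margin B K r * m.+1%:R) + 2 <= (m.+1 ^ 2)%N%:R ->
  score_floor m <= mean (score J T q B s u K r (m := m)).
Proof.
move=> c1 c2 c3 c4 c5 c6.
set n := (m.+1 ^ 2)%N; pose M : R := m.+1%:R.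
have nM : n%:R = M ^+ 2 :> R by rewrite natrX.
pose E0 (i : 'I_n) (k : nat) (f : cell_config m) : R :=
  (near_count (cell_dist R f) i (k.+1%:R * (M / J%:R))%R <= 0)%N%:R.
pose E1 (i : 'I_n) (k : nat) (f : cell_config m) : R :=
  (near_count (cell_dist R f) i (k.+1%:R * (M / J%:R))%R <= 1)%N%:R.
pose I0 (j : 'I_n) (f : cell_config m) : R := (isolated_cell B s K r f j)%:R.
pose Bd (i j : 'I_n) (k : nat) (f : cell_config m) : R :=
   [&& interior_cell (margin B K r * M) (f j), (near_count (cell_dist R f) j (s * M)%R <= 0)%N,
      cell_dist R f i j <= K * M &
      (near_count (cell_dist R f) i (cell_dist R f i j - k.+1%:R * (u * M))%R <= 1)%N]%:R.
have scoreE f : score J T q B s u K r f =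
   M ^- 3 * (\sum_i M / J%:R * \sum_(k < T) (E0 i k f + E1 i k f)
     + \sum_j (u * M) * \sum_(k < q) (2 * I0 j f + -1 * \sum_(i | i != j) Bd i j k f)).
  rewrite /score mulrC; congr (_ * (_ + _)).
  rewrite big_mkcond/=; apply: eq_bigr => j _; rewrite /I0 /Bd.
  rewrite /isolated_cell -/M; case: (boolP (_ && _)) => [/andP[-> ->]|nI].
    congr (_ * _); apply: eq_bigr => k _ /=; rewrite mulr1 mulN1r//.
  rewrite (eq_bigr (fun=> 0)) ?sumr_const ?mul0rn ?mulr0// => k _.
  rewrite big1 => [|i _]; last by rewrite andbA (negbTE nI).
  by rewrite !mulr0 addr0.
rewrite (eq_mean scoreE) meanZ meanD !mean_sum.
under eq_bigr => i _ do (rewrite meanZ mean_sum; under eq_bigr => k _ do rewrite meanD).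
under [X in _ + X]eq_bigr => j _ do (rewrite meanZ mean_sum;
  under eq_bigr => k _ do rewrite meanD meanZ meanZ mean_sum).
have nn : (n - 1)%N = n.-1 by rewrite subn1.
have tM (k : nat) : k.+1%:R * (M / J%:R) = t k * M by rewrite /t; ring.
have tM0 k : 0 < t k * M by rewrite mulr_gt0// divr_gt0// ltr0n.
have h1 (i : 'I_n) (k : 'I_T) :
    at_most_one_weight (n - 1) (disc_max (t k * M) / area m) 0
   + at_most_one_weight (n - 1) 0 (disc_max (t k * M) / area m) <=
   mean (E0 i k) + mean (E1 i k).
  rewrite nn; apply: lerD; rewrite /E0 /E1 tM.
    by apply: mean_near_count_le0 => //; exact: c1.
  by apply: mean_near_count_le1 => //; exact: c1.
have sM0 : 0 < s * M by rewrite mulr_gt0.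
have h2 (j : 'I_n) : inner m * at_most_one_weight (n - 1) (disc_max (s * M) / area m) 0 <= mean (I0 j).
  rewrite nn; apply: le_trans (mean_isolated (G0 m) j (margin B K r * M) sM0 c2).
  apply: ler_wpM2r.
    by apply: at_most_one_weight_ge0 => //; rewrite addr0 ler_pdivrMr// mul1r.
  rewrite /inner ler_pM2r ?invr_gt0//; apply: card_interior_ge => //.
  by rewrite mulr_ge0// ltW.
have UM (k : nat) : k.+1%:R * (u * M) = U k * M by rewrite /U mulrA.
have h3 (i j : 'I_n) (k : 'I_q) : i != j -> mean (Bd i j k) <=
    \sum_(b < B) (disc_max (r b.+1 * M) - disc_min (r b * M)) / area m *
        at_most_one_weight (n - 2) (disc_min (s * M) / area m) (crescent m k b / area m).
  move=> ij; rewrite /Bd UM.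
  have e b : r b * M - U k * M = (r b - U k) * M by rewrite mulrBl.
  have Uk : U k < s by exact: le_lt_trans (Uq k) qus.
  have := @mean_nonpaying R n n (G0 m) i j (s * M) (U k * M) (K * M) (margin B K r * M)
    (fun b => r b * M) B ij sM0.
  rewrite /= => H; apply: le_trans (H _ _ _ _ _ _ _ _ _ _) _.
  - by rewrite mulr_ge0 ?mulr_ge0 ?ltW.
  - by rewrite ltr_pM2r.
  - by rewrite r0.
  - by move=> b b' bb; rewrite ler_pM2r// rmono.
  - by rewrite ltr_pM2r.
  - by rewrite mulrA ler_pM2r// /margin lerDl; apply: le_trans (rs B); exact: ltW.
  - by rewrite ler_pM2r// /margin lerDr mulr_ge0// ltW.
  - exact: c3.
  - by move=> b bB; rewrite e; exact: (c4 k (Ordinal bB)).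
  - by move=> b bB; rewrite e; exact: (c5 k (Ordinal bB)).
  - by under eq_bigr => b _ do rewrite e.
pose X (k : 'I_q) := \sum_(b < B) (disc_max (r b.+1 * M) - disc_min (r b * M)) / area m *
        at_most_one_weight (n - 2) (disc_min (s * M) / area m) (crescent m k b / area m).
have X0 k : 0 <= X k.
  apply: sumr_ge0 => b _; rewrite mulr_ge0//.
    rewrite divr_ge0 ?(ltW (area0 m))// subr_ge0 disc_min_le_max ?ler_pM2r ?rmono//.
    by rewrite mulr_ge0 ?(ltW (M0 m))//; apply: le_trans (rs b); exact: ltW.
  apply: at_most_one_weight_ge0; first by rewrite divr_ge0 ?c4 ?(ltW (area0 m)).
  by rewrite -mulrDl ler_pdivrMr ?mul1r ?c5.
have h5 (j : 'I_n) (k : 'I_q) : \sum_(i | i != j) mean (Bd i j k) <= n%:R * X k.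
  apply: (@le_trans _ _ (\sum_(i | i != j) X k)); first by apply: ler_sum => i ij; exact: h3.
  rewrite mulr_natl -[in leRHS](card_ord n) -sumr_const big_mkcond/=.
  by apply: ler_sum => i _; case: ifP.
have nX (k : 'I_q) : n%:R * X k = \sum_(b < B) (disc_max (r b.+1 * M) - disc_min (r b * M)) / M ^+ 2 *
        at_most_one_weight (n - 2) (disc_min (s * M) / area m) (crescent m k b / area m).
  rewrite mulr_sumr; apply: eq_bigr => b _; rewrite mulrA; congr (_ * _).
  by rewrite nM areaE -/M; field; rewrite gt_eqF.
have -> : score_floor m = M ^- 3 *
  (\sum_(i < n) M / J%:R * \sum_(k < T)
    (at_most_one_weight (n - 1) (disc_max (t k * M) / area m) 0
   + at_most_one_weight (n - 1) 0 (disc_max (t k * M) / area m))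
  + \sum_(j < n) u * M * \sum_(k < q) (2 * (inner m *
        at_most_one_weight (n - 1) (disc_max (s * M) / area m) 0) - n%:R * X k)).
  rewrite (eq_bigr (fun k : 'I_q => 2 * (inner m *
        at_most_one_weight (n - 1) (disc_max (s * M) / area m) 0)
     - \sum_(b < B) (disc_max (r b.+1 * M) - disc_min (r b * M)) / M ^+ 2 *
        at_most_one_weight (n - 2) (disc_min (s * M) / area m) (crescent m k b / area m))
     (F1 := fun k => _ - n%:R * X k)); last by move=> k _; rewrite nX.
  rewrite /score_floor -/n -/M !sumr_const card_ord.
  set A := \sum_(k < T) _; set C := \sum_(k < q) _.
  rewrite -[X in _ = _ * (X + _)]mulr_natl -[X in _ = _ * (_ + X)]mulr_natl nM.
  have Jn0 : J%:R != 0 :> R by rewrite pnatr_eq0 -lt0n.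
  by clearbody A C; field; rewrite Jn0 gt_eqF.
rewrite ler_pM2l ?invr_gt0 ?exprn_gt0//; apply: lerD; apply: ler_sum => i _.
  rewrite ler_wpM2l ?divr_ge0 ?(ltW (M0 m))//; apply: ler_sum => k _; exact: h1.
rewrite ler_wpM2l ?mulr_ge0 ?(ltW u0) ?(ltW (M0 m))//; apply: ler_sum => k _.
by rewrite mulN1r lerB ?h5// ler_wpM2l.
Qed.

Let v (m : nat) : R := m.+1%:R^-1.

Let cvg_v : v @ \oo --> (0 : R).
Proof. exact: cvg_harmonic. Qed.

Let overM (x : R) m : x / area m = (x / m.+1%:R ^+ 2) / m.+1%:R ^+ 2.
Proof. by rewrite areaE; field; rewrite gt_eqF. Qed.

Let cvg_inner : inner @ \oo --> (1 : R).
Proof.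
pose w m := 1 - 2 * margin B K r * v m - 2 * (v m * v m).
have -> : inner = (fun m => w m * w m).
  apply/funext => m; rewrite /inner /w areaE natrX /v; field.
  by rewrite gt_eqF.
have cw : w @ \oo --> (1 : R).
  rewrite -[X in _ --> X]subr0 -[X in _ --> X - _]subr0 /w.
  apply: cvgB; last first.
    have vv : (fun m => v m * v m) @ \oo --> (0 : R).
      by rewrite -[X in _ --> X](mulr0 0); exact: cvgM.
    by rewrite -[X in _ --> X](mulr0 2); apply: cvgM => //; exact: cvg_cst.
  apply: cvgB; first exact: cvg_cst.
  by rewrite -[X in _ --> X](mulr0 (2 * margin B K r)); apply: cvgM => //; exact: cvg_cst.
by rewrite -[X in _ --> X]mulr1; exact: cvgM.
Qed.

Let cvg_crescent k b : (fun m => crescent m k b / m.+1%:R ^+ 2) @ \oo -->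
  pi * (r b - U k) ^+ 2 - pi * s ^+ 2 / 2.
Proof.
have -> : (fun m => crescent m k b / m.+1%:R ^+ 2) = (fun m =>
   disc_min ((r b - U k) * m.+1%:R) / m.+1%:R ^+ 2
   - disc_max (s * m.+1%:R) / m.+1%:R ^+ 2 / 2).
  by apply/funext => m; rewrite /crescent; field; rewrite gt_eqF.
apply: cvgB; first exact: cvg_disc_min.
by apply: cvgM; [exact: cvg_disc_max|exact: cvg_cst].
Qed.

Let cvg_score_floor : score_floor @ \oo --> score_limit.
Proof.
rewrite /score_floor /score_limit; apply: cvgD.
  apply: cvgM; first exact: cvg_cst.
  apply: cvg_sum_seq => k; apply: cvgD.
    under eq_fun => m do rewrite overM -[X in at_most_one_weight _ _ X](mul0r (m.+1%:R ^+ 2)^-1).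
    by apply: cvg_at_most_one_weight; [exact: cvg_disc_max|exact: cvg_cst].
  under eq_fun => m do rewrite overM -[X in at_most_one_weight _ X _](mul0r (m.+1%:R ^+ 2)^-1).
  by apply: cvg_at_most_one_weight; [exact: cvg_cst|exact: cvg_disc_max].
apply: cvgM; first exact: cvg_cst.
apply: cvg_sum_seq => k; apply: cvgB.
  apply: cvgM; first exact: cvg_cst.
  apply: cvgM; first exact: cvg_inner.
  under eq_fun => m do rewrite overM -[X in at_most_one_weight _ _ X](mul0r (m.+1%:R ^+ 2)^-1).
  by apply: cvg_at_most_one_weight; [exact: cvg_disc_max|exact: cvg_cst].
apply: cvg_sum_seq => b; apply: cvgM.
  under eq_fun => m do rewrite mulrBl.
  by apply: cvgB; [exact: cvg_disc_max|exact: cvg_disc_min].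
under eq_fun => m do rewrite (overM (disc_min _)) (overM (crescent _ _ _)).
by apply: cvg_at_most_one_weight; [exact: cvg_disc_min|exact: cvg_crescent].
Qed.

Let near_le_area (x : nat -> R) (l : R) : (fun m => x m / m.+1%:R ^+ 2) @ \oo --> l ->
  \forall m \near \oo, x m <= area m.
Proof.
move=> xl; near=> m.
have h1 : x m / m.+1%:R ^+ 2 <= l + 1.
  by near: m; apply: (cvgr_le _ xl); rewrite ltrDl.
have h2 : l + 1 <= m.+1%:R.
  near: m; exists (Num.bound `|l + 1|) => // m /= bm.
  apply: le_trans (ler_norm _) _; apply: le_trans (ltW (archi_boundP (normr_ge0 _))) _.
  by rewrite ler_nat (leq_trans bm).
have M1 : 1 <= m.+1%:R :> R by rewrite ler1n.
rewrite areaE -ler_pdivrMr ?exprn_gt0//; apply: le_trans h1 _; apply: le_trans h2 _.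
by rewrite expr2 ler_peMl.
Unshelve. all: end_near. Qed.

Let near_ge0 (x : nat -> R) (l : R) : (fun m => x m / m.+1%:R ^+ 2) @ \oo --> l -> 0 < l ->
  \forall m \near \oo, 0 <= x m.
Proof.
move=> xl l0; near=> m.
have : 0 < x m / m.+1%:R ^+ 2 by near: m; exact: (cvgr_gt _ xl).
by rewrite pmulr_lgt0 ?invr_gt0 ?exprn_gt0// => /ltW.
Unshelve. all: end_near. Qed.

Lemma mean_score_floor : exists2 low : nat -> R, low @ \oo --> score_limit &
  \forall m \near \oo, low m <= mean (score J T q B s u K r (m := m)).
Proof.
exists score_floor; first exact: cvg_score_floor.
have cr0 (k : 'I_q) (b : 'I_B) : 0 < pi * (r b - U k) ^+ 2 - pi * s ^+ 2 / 2.
  rewrite -mulrA -mulrBr mulr_gt0 ?pi_gt0// subr_gt0; apply: lt_le_trans sep _.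
  have := Uq k; have := rs b; have := qus => h1 h2 h3.
  by rewrite !expr2; apply: ler_pM; lra.
have s2 : 0 < pi * s ^+ 2 by rewrite mulr_gt0 ?pi_gt0 ?exprn_gt0.
have near_min : \forall m \near \oo, 0 <= disc_min (s * m.+1%:R).
  exact: (near_ge0 (@cvg_disc_min R s) s2).
near=> m; apply: mean_score_ge.
- near: m; apply: filter_forall => k; apply: near_le_area; exact: cvg_disc_max.
- by near: m; apply: near_le_area; exact: cvg_disc_max.
- by near: m.
- near: m; apply: filter_forall => k; apply: filter_forall => b.
  exact: (near_ge0 (@cvg_crescent k b) (cr0 k b)).
- near: m; apply: filter_forall => k; apply: filter_forall => b.
  apply: near_le_area; under eq_fun => m do rewrite mulrDl.
  by apply: cvgD; [exact: cvg_disc_min|exact: cvg_crescent].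
- have : 2 * margin B K r + 2 <= m.+1%:R.
    near: m; exists (Num.bound (2 * margin B K r + 2)) => // m /= bm.
    apply: le_trans (ltW (archi_boundP _)) _; first by have := margin0; lra.
    by rewrite ler_nat (leq_trans bm).
  have M1 : 1 <= m.+1%:R :> R by rewrite ler1n.
  rewrite natrX; have := margin0; set mg := margin B K r; set M := m.+1%:R in M1 * => h1 h2.
  nra.
Unshelve. all: end_near. Qed.

End MeanScore.


(** * From means over cells to the almost sure limit *)

Section CellEvents.
Context {R : realType} {d : measure_display} {T : measurableType d}.
Variables (P : probability T R) (X : nat -> {RV P >-> (R * R)%type}).
Hypothesis iidX : iid_uniform_unit_square P X.

Definition cell_side (G : nat) (a : nat) : set R := `[a%:R / G%:R, a.+1%:R / G%:R[%classic.

Definition cell (G : nat) (c : 'I_G * 'I_G) : set (R * R) := cell_side G c.1 `*` cell_side G c.2.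

Lemma cell_sideP G a x : (0 < G)%N -> cell_side G a x <-> a%:R <= G%:R * x < a.+1%:R.
Proof.
move=> G0; have G0R : 0 < G%:R :> R by rewrite ltr0n.
by rewrite /cell_side/= in_itv/= ler_pdivrMr// ltr_pdivlMr// [x * _]mulrC.
Qed.

Lemma measurable_cell G (c : 'I_G * 'I_G) : measurable (cell c).
Proof. by apply: measurableX; exact: measurable_itv. Qed.

Lemma prob_cell G (c : 'I_G * 'I_G) i : (0 < G)%N ->
  P (X i @^-1` cell c) = ((G%:R ^+ 2)^-1)%:E.
Proof.
move=> G0; have G0R : 0 < G%:R :> R by rewrite ltr0n.
have [_ /(_ i)] := iidX; move=> /(_ _ (measurable_cell c)).
rewrite /distribution/= /pushforward => ->.
have sub (a : 'I_G) : cell_side G a `<=` `[0, 1]%classic.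
  move=> x /(cell_sideP _ _ G0) /andP[h1 h2]; rewrite /= in_itv/=; apply/andP; split.
    by rewrite -(pmulr_rge0 _ G0R); apply: le_trans h1.
  rewrite -(ler_pM2l G0R) mulr1; apply: ltW; apply: lt_le_trans h2 _.
  by rewrite ler_nat.
have -> : cell c `&` unit_square = cell c.
  by apply/setIidl => -[x y] [/= h1 h2]; split; [exact: sub h1|exact: sub h2].
have leb (a : 'I_G) : lebesgue_measure (cell_side G a) = (G%:R^-1)%:E :> \bar R.
  rewrite /cell_side lebesgue_measure_itv/= lte_fin ltr_pM2r ?invr_gt0// ltr_nat ltnSn.
  by rewrite -EFinB -mulrBl -natr1 addrAC subrr add0r mul1r.
rewrite /cell product_measure1E; [|exact: measurable_itv|exact: measurable_itv].
by rewrite [X in (X * _)%E](leb c.1) [X in (_ * X)%E](leb c.2) -EFinM -invfM expr2.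
Qed.

Definition cells_event (m : nat) (f : cell_config m) : set T :=
  \bigcap_(i in [set: 'I_(m.+1 ^ 2)]) X i @^-1` cell (f i).

(** Independence is expressed with one set for every natural number, hence the
    detour through [insub]. *)
Lemma cells_eventE m (f : cell_config m) :
  cells_event f = \bigcap_(i in [set` iota 0 (m.+1 ^ 2)])
    X i @^-1` (if insub i is Some j then cell (f j) else setT).
Proof.
have iotaE (i : nat) : (i \in iota 0 (m.+1 ^ 2)) = (i < m.+1 ^ 2)%N.
  by rewrite mem_iota add0n.
apply/seteqP; split=> w h i.
  move=> im; have {}im : (i < m.+1 ^ 2)%N by rewrite -iotaE; exact: im.
  by rewrite insubT; exact: h.
move=> _; have im : [set` iota 0 (m.+1 ^ 2)] (i : nat) by rewrite /mkset iotaE.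
by have := h i im; rewrite valK.
Qed.

Lemma prob_cells_event m (f : cell_config m) :
  P (cells_event f) = (#|{: 'I_(m.+1 ^ 2) * 'I_(m.+1 ^ 2)}|%:R^-1 ^+ (m.+1 ^ 2))%:E.
Proof.
have [indX _] := iidX.
rewrite cells_eventE indX ?iota_uniq//; last first.
  move=> i _; case: insub => [j|]; [exact: measurable_cell|exact: measurableT].
rewrite -{1}[X in iota 0 X]subn0 -/(index_iota 0 (m.+1 ^ 2)) big_mkord.
rewrite (eq_bigr (fun=> ((((m.+1 ^ 2)%N%:R ^+ 2)^-1 : R)%:E))); last first.
  by move=> i _; rewrite valK prob_cell// expn_gt0.
rewrite cardV natrM -expr2; set x := _^-1.
rewrite prodEFin.
by rewrite prodr_const card_ord.
Qed.

Lemma measurable_cells_event m (f : cell_config m) : measurable (cells_event f).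
Proof.
rewrite /cells_event; apply: fin_bigcap_measurable => // i _.
by apply: measurable_funPTI; exact: measurable_cell.
Qed.

Lemma cell_side_inj G (a b : 'I_G) x : cell_side G a x -> cell_side G b x -> a = b.
Proof.
move=> ha; have G0 : (0 < G)%N by exact: leq_ltn_trans (ltn_ord a).
move: ha => /(cell_sideP _ _ G0)/andP[a1 a2] /(cell_sideP _ _ G0)/andP[b1 b2].
have ab : (a < b.+1)%N by rewrite -(ltr_nat R); exact: le_lt_trans a1 b2.
have ba : (b < a.+1)%N by rewrite -(ltr_nat R); exact: le_lt_trans b1 a2.
by apply/val_inj/eqP; rewrite eqn_leq -ltnS ab -ltnS ba.
Qed.

Lemma trivIset_cells_event m : trivIset [set: cell_config m] (@cells_event m).
Proof.
move=> f g _ _ [w [hf hg]]; apply/ffunP => i.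
have [f1 f2] := hf i I; have [g1 g2] := hg i I.
by rewrite [f i]surjective_pairing [g i]surjective_pairing (cell_side_inj f1 g1) (cell_side_inj f2 g2).
Qed.

Definition high_event (m : nat) (phi : cell_config m -> R) (gamma : R) : set T :=
  \bigcup_(f in [set f | gamma < phi f]) cells_event f.

Lemma measurable_high_event m phi gamma : measurable (@high_event m phi gamma).
Proof.
apply: fin_bigcup_measurable; first exact: finite_finset.
by move=> f _; exact: measurable_cells_event.
Qed.

(** Under the law of the points the configuration of cells is uniform, and the
    configurations are disjoint events. *)
Lemma mean_le_high_event m (phi : cell_config m -> R) (gamma C : R) : 0 <= C ->
  (forall f, phi f <= gamma + C) ->
  mean phi <= gamma + C * fine (P (high_event phi gamma)).
Proof.
move=> C0 hC.
set mu : R := #|{: 'I_(m.+1 ^ 2) * 'I_(m.+1 ^ 2)}|%:R^-1.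
set N := (m.+1 ^ 2)%N.
have one : \sum_(f : cell_config m) mu ^+ N = 1.
  rewrite sumr_const card_ffun card_ord -/N -mulr_natl natrX -exprMn /mu divff ?expr1n//.
  by rewrite pnatr_eq0 -lt0n V_gt0// expn_gt0.
have PE : fine (P (high_event phi gamma)) = \sum_(f : cell_config m | gamma < phi f) mu ^+ N.
  rewrite /high_event measure_fin_bigcup; last 3 first.
  - exact: finite_finset.
  - by apply: sub_trivIset (@trivIset_cells_event m).
  - by move=> f _; exact: measurable_cells_event.
  rewrite (eq_fsbigr (fun=> (mu ^+ N)%:E)); last by move=> f _; exact: prob_cells_event.
  have E : (\sum_(f : cell_config m | (gamma < phi f)%R) (mu ^+ N)%:E =
      \sum_(f \in [set f | (gamma < phi f)%R]) (mu ^+ N)%:E)%E.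
    by apply: bigfs (index_enum_uniq _) _ => f _; rewrite mem_index_enum.
  by rewrite -E sumEFin.
apply: (@le_trans _ _ (\sum_(f : cell_config m) mu ^+ N * (gamma + C * (gamma < phi f)%R%:R))).
  apply: ler_sum => f _; rewrite ler_wpM2l ?exprn_ge0 ?invr_ge0//.
  by case: ltP => h /=; rewrite ?mulr1 ?mulr0 ?addr0.
rewrite PE; under eq_bigr do rewrite mulrDr mulrCA.
rewrite big_split/= -mulr_suml one mul1r lerD2l -mulr_sumr ler_wpM2l//.
rewrite [leRHS]big_mkcond/=; apply: ler_sum => f _.
by case: ifP; rewrite ?mulr1 ?mulr0.
Qed.

End CellEvents.


Section Link.
Context {R : realType} {d : measure_display} {T : measurableType d}.
Variables (P : probability T R) (X : nat -> {RV P >-> (R * R)%type}) (beta : R).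
Hypothesis iidX : iid_uniform_unit_square P X.
Hypothesis betaP : {ae P, forall w : T,
     (fun n : nat => tsp_length (fun i : 'I_n => X i w) / Num.sqrt (n%:R : R))
       @ \oo --> beta}.

Lemma tsp_squares_cvg (w : T) :
  (fun n : nat => tsp_length (fun i : 'I_n => X i w) / Num.sqrt (n%:R : R)) @ \oo --> beta ->
  (fun m : nat => tsp_length (fun i : 'I_(m.+1 ^ 2) => X i w) / m.+1%:R) @ \oo --> beta.
Proof.
move=> h.
have sq : (fun m => (m.+1 ^ 2)%N) @ \oo --> \oo.
  move=> A [N _ NA]; exists N => // m /= Nm; apply: NA => /=.
  by apply: leq_trans Nm _; nia.
have -> : (fun m : nat => tsp_length (fun i : 'I_(m.+1 ^ 2) => X i w) / m.+1%:R) =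
   (fun n : nat => tsp_length (fun i : 'I_n => X i w) / Num.sqrt (n%:R : R)) \o
     (fun m => (m.+1 ^ 2)%N).
  by apply/funext => m /=; rewrite natrX sqrtr_sqr ger0_norm.
exact: cvg_comp sq h.
Qed.

(** Continuity from above along the tails whose intersection is the limit superior. *)
Lemma prob_cvg0_of_ae (A : (set T)^nat) : (forall m, measurable (A m)) ->
  {ae P, forall w, \forall m \near \oo, ~ A m w} ->
  fine (P (A m)) @[m --> \oo] --> (0 : R).
Proof.
move=> mA aeA.
have mlim : measurable (lim_sup_set A).
  by apply: bigcap_measurable => // k _; apply: bigcup_measurable => j _; exact: mA.
have lim0 : P (lim_sup_set A) = 0%E.
  apply: measure_negligible => //; apply: negligibleS aeA => w /= hw [N _ NA].
  by have [j /= Nj Aj] := hw N I; exact: (NA j Nj).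
have c : P (\bigcup_(k >= n) A k) @[n --> \oo] --> 0%E.
  rewrite -lim0; apply: lim_sup_set_cvg => //.
  have mU : measurable (\bigcup_(k >= 0) A k) by apply: bigcup_measurable => k _; exact: mA.
  by apply: le_lt_trans (probability_le1 P mU) _; exact: ltry.
have c2 : P (A m) @[m --> \oo] --> 0%E.
  apply: squeeze_cvge (cvg_cst 0%E) c; apply: nearW => m; rewrite measure_ge0/=.
  apply: le_measure; rewrite ?inE//; first by apply: bigcup_measurable => j _; exact: mA.
  by move=> w Aw; exists m => //=.
exact: (fine_cvg c2).
Qed.

Variables (J Tn q B : nat) (s u K eta : R) (r : nat -> R).
Hypotheses (J0 : (0 < J)%N) (u0 : 0 < u) (s0 : 0 < s) (K0 : 0 < K).
Hypotheses (qus : q%:R * u < s) (r0 : r 0%N = s).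
Hypotheses (rmono : {homo r : a b / (a <= b)%N >-> a <= b}) (KrB : K < r B).
Hypothesis sep : s ^+ 2 / 2 < (s - q%:R * u) ^+ 2.
Hypotheses (eta0 : 0 <= eta) (qeta : q%:R * u <= eta * K).

(** Otherwise fix [gamma] between the two sides.  Almost surely [score] is
    eventually below [gamma], so the probability that it exceeds [gamma] tends
    to 0; being bounded above, [score] then has a mean that is asymptotically at
    most [gamma]. *)
Lemma score_limit_le : score_limit J Tn q B s u r <= (1 + eta) * 2 * beta.
Proof.
rewrite leNgt; apply/negP => hlt.
set L := score_limit J Tn q B s u r in hlt.
pose gamma := (L + (1 + eta) * 2 * beta) / 2.
have g1 : gamma < L by rewrite /gamma; lra.
have g2 : (1 + eta) * 2 * beta < gamma by rewrite /gamma; lra.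
pose sc m : cell_config m -> R := score J Tn q B s u K r (m := m).
pose H m : set T := high_event X (sc m) gamma.
have mH m : measurable (H m) by exact: measurable_high_event.
have aeH : {ae P, forall w, \forall m \near \oo, ~ H m w}.
  apply: filterS betaP => w /tsp_squares_cvg cw.
  have cb : (fun m : nat => (1 + eta) * 2 * (tsp_length (fun i : 'I_(m.+1 ^ 2) => X i w) / m.+1%:R
      + 2 / m.+1%:R)) @ \oo --> (1 + eta) * 2 * beta.
    apply: cvgM; first exact: cvg_cst.
    rewrite -[X in _ --> X]addr0; apply: cvgD => //.
    by rewrite -[X in _ --> X](mulr0 2); apply: cvgM; [exact: cvg_cst|exact: cvg_harmonic].
  near=> m => -[f /= gf fw].
  have m0 : (0 < m)%N by near: m; exact: nbhs_infty_gt.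
  have G0 : (0 < m.+1 ^ 2)%N by rewrite expn_gt0.
  have := @tsp_ge_score R J Tn q B s u K r J0 u0 m f (fun i => X i w) eta m0 eta0 qeta.
  move=> hsc; have : sc m f < gamma.
    apply: le_lt_trans (hsc _) _.
      by move=> i; have [c1 c2] := fw i I; split; apply/(cell_sideP _ _ G0).
    by near: m; exact: (cvgr_lt _ cb).
  by rewrite ltNge (ltW gf).
have P0 := prob_cvg0_of_ae mH aeH.
have [low lowL lowmean] := @mean_score_floor R J Tn q B s u K r J0 u0 s0 K0 qus r0 rmono KrB sep.
pose C := `|score_sup J Tn q u - gamma|.
have C0 : 0 <= C by exact: normr_ge0.
have up : (fun m => gamma + C * fine (P (H m))) @ \oo --> gamma.
  rewrite -[X in _ --> X]addr0; apply: cvgD; first exact: cvg_cst.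
  by rewrite -[X in _ --> X](mulr0 C); apply: cvgM => //; exact: cvg_cst.
have : L <= gamma.
  apply: ler_cvg_to lowL up _; near=> m.
  apply: (@le_trans _ _ (mean (sc m))); first by near: m; exact: lowmean.
  apply: mean_le_high_event => // f.
  apply: le_trans (@score_le_sup R J Tn q B s u K r J0 u0 m f) _.
  by rewrite -lerBlDl ler_norm.
by rewrite leNgt g1.
Unshelve. all: end_near. Qed.

End Link.


(** * The Poisson sum over the annuli *)

Section PoissonTail.
Variable R : realType.

(** The integral over [t >= l] of [exp (- t) * (1 + t)], the probability that a
    Poisson variable of mean [t] is at most 1. *)
Definition poisson_tail (l : R) : R := expR (- l) * (2 + l).

Lemma tail_ge0 l : 0 <= l -> 0 <= poisson_tail l.
Proof. by move=> l0; rewrite mulr_ge0 ?expR_ge0//; lra. Qed.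

Lemma tail_le a b : 0 <= a -> a <= b -> poisson_tail b <= poisson_tail a.
Proof.
move=> a0 ab; have E : expR (- a) = expR (- b) * expR (b - a).
  by rewrite -expRD; congr expR; ring.
rewrite /poisson_tail E -mulrA ler_pM2l ?expR_gt0//.
have := expR_ge1Dx (b - a) => h.
apply: (@le_trans _ _ ((1 + (b - a)) * (2 + a))); first nra.
by rewrite ler_wpM2r//; lra.
Qed.

(** A Riemann sum with steps at most [dl] overestimates the integral by a factor at
    most [exp dl]. *)
Lemma tail_drop (l x dl : R) : 0 <= l -> 0 <= x -> x <= dl ->
  x * (expR (- l) * (1 + l)) <= expR dl * (poisson_tail l - poisson_tail (l + x)).
Proof.
move=> l0 x0 xd.
apply: (@le_trans _ _ (expR x * (poisson_tail l - poisson_tail (l + x)))); last first.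
  rewrite ler_wpM2r ?ler_expR// subr_ge0; apply: tail_le => //; lra.
rewrite /poisson_tail opprD expRD.
have -> : expR x * (expR (- l) * (2 + l) - expR (- l) * expR (- x) * (2 + (l + x))) =
   expR (- l) * (expR x * (2 + l) - (expR x * expR (- x)) * (2 + (l + x))) by ring.
rewrite expRxMexpNx_1 mul1r mulrCA ler_pM2l ?expR_gt0//.
have := expR_ge1Dx x => h.
have : (1 + x) * (2 + l) <= expR x * (2 + l) by rewrite ler_wpM2r//; lra.
nra.
Qed.

(** The annuli have equal areas [dl].  Their images under the shift of the radius by
    [U] have areas between [theta * dl] and [dl], so that up to the factor
    [1 / theta] the sum is a Riemann sum with steps at most [dl]. *)
Lemma annuli_tail_sum (r : nat -> R) (s U theta dl : R) (B : nat) :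
  0 < theta -> theta <= 1 -> 0 < s -> U = (1 - theta) * s -> 0 <= dl ->
  (forall b, s <= r b) -> r 0%N = s ->
  {homo r : a b / (a <= b)%N >-> a <= b} ->
  (forall b, pi * r b.+1 ^+ 2 - pi * r b ^+ 2 = dl) ->
  2^-1 <= theta ^+ 2 ->
  \sum_(b < B) (pi * r b.+1 ^+ 2 - pi * r b ^+ 2) *
    (expR (- (pi * (r b - U) ^+ 2 - pi * s ^+ 2 / 2)) *
       (1 + (pi * (r b - U) ^+ 2 - pi * s ^+ 2 / 2)))
  <= expR dl / theta * poisson_tail (pi * s ^+ 2 * (theta ^+ 2 - 2^-1)).
Proof.
move=> th0 th1 s0 UE dl0 rs r0 rmono rdl thh.
pose l b := pi * (r b - U) ^+ 2 - pi * s ^+ 2 / 2.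
have pi0 := pi_gt0 R.
have U0 : 0 <= U by rewrite UE mulr_ge0 ?subr_ge0// ltW.
have l00 : l 0%N = pi * s ^+ 2 * (theta ^+ 2 - 2^-1) by rewrite /l r0 UE; field.
have l0 b : 0 <= l b.
  have : theta * s <= r b - U by rewrite UE; have := rs b; nra.
  move=> h; have h2 : (theta * s) ^+ 2 <= (r b - U) ^+ 2.
    by rewrite !expr2 ler_pM// mulr_ge0// ltW.
  rewrite /l subr_ge0 -mulrA ler_pM2l//; apply: le_trans h2.
  by rewrite exprMn mulrC ler_pM2r ?exprn_gt0.
have step b : 0 <= l b.+1 - l b <= dl /\ theta * dl <= l b.+1 - l b.
  have rr := rmono _ _ (leqnSn b); have s1 := rs b; have s2 := rs b.+1.
  have E : l b.+1 - l b = pi * ((r b.+1 - r b) * (r b.+1 + r b - 2 * U)) by rewrite /l; ring.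
  have D : dl = pi * ((r b.+1 - r b) * (r b.+1 + r b)) by rewrite -(rdl b); ring.
  have h1 : theta * (r b.+1 + r b) <= r b.+1 + r b - 2 * U.
    have : (1 - theta) * (2 * s) <= (1 - theta) * (r b.+1 + r b).
      by rewrite ler_wpM2l ?subr_ge0//; lra.
    by rewrite UE; lra.
  have h2 : theta * dl <= l b.+1 - l b.
    rewrite E D mulrCA ler_pM2l// mulrCA ler_wpM2l//; lra.
  split => //; apply/andP; split; first by apply: le_trans h2; rewrite mulr_ge0// ltW.
  by rewrite E D ler_pM2l// ler_wpM2l ?subr_ge0//; lra.
apply: (@le_trans _ _ (\sum_(b < B) expR dl / theta * (poisson_tail (l b) - poisson_tail (l b.+1)))).
  apply: ler_sum => b _; rewrite rdl -/(l b).
  have [/andP[x0 x1] x2] := step b.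
  have := tail_drop (l0 b) x0 x1; rewrite [l b + _]addrC subrK => h.
  have w0 : 0 <= expR (- l b) * (1 + l b).
    by rewrite mulr_ge0 ?expR_ge0// addr_ge0// l0.
  have h2 : theta * (dl * (expR (- l b) * (1 + l b))) <= expR dl * (poisson_tail (l b) - poisson_tail (l b.+1)).
    by apply: le_trans h; rewrite mulrA ler_wpM2r.
  by rewrite mulrAC ler_pdivlMr// mulrC.
rewrite -mulr_sumr -l00 ler_wpM2l ?divr_ge0 ?expR_ge0 ?(ltW th0)//.
have -> : \sum_(b < B) (poisson_tail (l b) - poisson_tail (l b.+1)) = poisson_tail (l 0%N) - poisson_tail (l B).
  elim: B => [|B IH]; first by rewrite big_ord0 subrr.
  by rewrite big_ord_recr/= IH; ring.
by rewrite gerBl tail_ge0.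
Qed.

Lemma expR_ge_partial (x : R) n : 0 <= x -> \sum_(0 <= i < n) x ^+ i / i`!%:R <= expR x.
Proof.
move=> x0; have := @nondecreasing_cvgn_le R (series (exp_coeff x)).
apply; last exact: is_cvg_series_exp_coeff.
apply/nondecreasing_seqP => k; rewrite /series/= big_nat_recr//= lerDl.
by rewrite /exp_coeff/= divr_ge0// exprn_ge0.
Qed.

End PoissonTail.

(** * The Gaussian integral behind 5/8 *)

Section GaussSum.
Variable R : realType.
Import gauss_integral_proof.
Let mu : {measure set _ -> \bar R} := @lebesgue_measure R.

Let gauss_derive (x : R) : 0 < x -> is_derive x (1 : R) (@integral0_gauss R) (expR (- x ^+ 2)).
Proof.
move=> x0.
have [h1 h2] : derivable (@integral0_gauss R) x 1 /\ derive1 (@integral0_gauss R) x = gauss_fun x.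
  apply: (@continuous_FTC1_closed R gauss_fun 0 x (x + 1)) => //.
  - by rewrite ltrDl.
  - apply: continuous_compact_integrable => //; first exact: segment_compact.
    by apply: continuous_subspaceT; exact: continuous_gauss_fun.
  - exact: continuous_gauss_fun.
by apply: DeriveDef => //; rewrite -derive1E h2.
Qed.

Let cvg_integral0_gauss : (@integral0_gauss R) x @[x --> +oo] --> Num.sqrt pi / 2.
Proof.
have : Num.sqrt (@integral0_gauss R x ^+ 2) @[x --> +oo] --> Num.sqrt (pi / 4).
  by apply: continuous_cvg; [exact: sqrt_continuous|exact: cvg_integral0_gauss_sqr].
rewrite sqrtrM ?pi_ge0// sqrtrV// (_ : 4 = 2 ^+ 2); last by rewrite expr2 -natrM.
rewrite sqrtr_sqr ger0_norm//.
rewrite (_ : (fun _ => Num.sqrt _) = @integral0_gauss R)//.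
by apply/funext => r; rewrite sqrtr_sqr// ger0_norm// integral0_gauss_ge0.
Qed.

Let integral0_gauss_le (x : R) : 0 < x -> integral0_gauss x <= x.
Proof.
move=> x0.
have itg (f : R -> R) : continuous f -> mu.-integrable `[0, x] (EFin \o f).
  move=> cf; apply: continuous_compact_integrable; first exact: segment_compact.
  exact: continuous_subspaceT.
have c1 : continuous (cst 1 : R -> R) by move=> y; exact: cvg_cst.
have h := @le_Rintegral _ _ _ mu `[0, x] (@gauss_fun R) (cst 1) (measurable_itv _)
  (itg _ (@continuous_gauss_fun R)) (itg _ c1) (fun y _ => gauss_fun_le1 y).
apply: le_trans h _; rewrite Rintegral_cst ?measurable_itv// mul1r.
have -> : mu `[0, x]%classic = x%:E; last by [].
apply: etrans (lebesgue_measure_itv `[0, x]) _.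
by rewrite /= lte_fin x0 oppr0 adde0.
Qed.

(** A primitive of [poisson_tail (y ^+ 2)]. *)
Let psi (y : R) : R := 5 / 2 * integral0_gauss y - 2^-1 * (y * expR (- y ^+ 2)).

Let psi_derive (y : R) : 0 < y -> is_derive y (1 : R) psi (poisson_tail (y ^+ 2)).
Proof.
move=> y0; have := gauss_derive y0 => hg.
rewrite /psi; apply: is_derive_eq.
by rewrite /poisson_tail /GRing.scale/=; field.
Qed.

Let psi_step (a b : R) : 0 < a -> a <= b -> psi b - psi a <= poisson_tail (a ^+ 2) * (b - a).
Proof.
move=> a0 ab.
have pos (x : R) : a <= x -> 0 < x by exact: lt_le_trans.
have cf : {within `[a, b], continuous psi}.
  apply: derivable_within_continuous => x; rewrite in_itv/= => /andP[ax _].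
  by have [] := psi_derive (pos _ ax).
have fd (x : R) : x \in `]a, b[ -> is_derive x (1 : R) psi (poisson_tail (x ^+ 2)).
  by rewrite in_itv/= => /andP[ax _]; apply: psi_derive; apply: pos; exact: ltW.
have [c cab ->] := MVT_segment ab fd cf.
rewrite ler_wpM2r ?subr_ge0//; move: cab; rewrite in_itv/= => /andP[ac _].
by apply: tail_le; rewrite ?sqr_ge0// !expr2 ler_pM// ltW.
Qed.

Let cvg_psi : psi y @[y --> +oo] --> (5 / 2 * (Num.sqrt pi / 2) : R).
Proof.
rewrite -[X in _ --> X]subr0; apply: cvgB.
  by apply: cvgM; [exact: cvg_cst|exact: cvg_integral0_gauss].
rewrite -[X in _ --> X](mulr0 2^-1); apply: cvgM; first exact: cvg_cst.
apply: (@squeeze_cvgr _ _ _ _ (cst 0) (fun y : R => y^-1)).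
- near=> y; have y0 : 0 < y by near: y; exact: nbhs_pinfty_gt.
  rewrite /= mulr_ge0 ?expR_ge0 ?(ltW y0)//= expRN.
  rewrite ler_pdivrMr ?expR_gt0//; apply: (@le_trans _ _ (y^-1 * (1 + y ^+ 2))).
    by rewrite mulrDr mulr1 expr2 mulrA mulVf ?gt_eqF// mul1r lerDr invr_ge0 ltW.
  by rewrite ler_pM2l ?invr_gt0// expR_ge1Dx.
- exact: cvg_cst.
- by apply/gtr0_cvgV0; [exact: nbhs_pinfty_gt|exact: cvg_id].
Unshelve. all: end_near. Qed.

(** At the threshold [t] the two indicators in [score] have asymptotic means
    [exp (- a)] and [exp (- a) * (1 + a)] with [a = pi * t ^+ 2]; their sum is
    [poisson_tail a].  Its integral over [t >= 0] is [5 / 4], the sum of the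
    means [1 / 2] and [3 / 4] of [D1] and [D2]. *)
Lemma gauss_riemann_sum : exists2 low : nat -> R, low @ \oo --> (5 / 4 : R) &
  forall m, low m <= m.+1%:R^-1 *
    \sum_(k < m.+1 * m.+1) poisson_tail (pi * (k.+1%:R / m.+1%:R) ^+ 2).
Proof.
have sp0 : 0 < Num.sqrt pi :> R by rewrite sqrtr_gt0 pi_gt0.
have sp2 : Num.sqrt pi ^+ 2 = pi :> R by rewrite sqr_sqrtr ?pi_ge0.
pose eps m : R := Num.sqrt pi / m.+1%:R.
have eps0 m : 0 < eps m by rewrite divr_gt0.
pose y m : R := (m.+1 * m.+1).+1%:R * eps m.
exists (fun m => (Num.sqrt pi)^-1 * psi (y m) - 5 / 2 * m.+1%:R^-1).
  rewrite -[X in _ --> X]subr0; apply: cvgB; last first.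
    rewrite -[X in _ --> X](mulr0 (5 / 2)); apply: cvgM; [exact: cvg_cst|exact: cvg_harmonic].
  have -> : (5 / 4 : R) = (Num.sqrt pi)^-1 * (5 / 2 * (Num.sqrt pi / 2)).
    by field; rewrite gt_eqF.
  apply: cvgM; first exact: cvg_cst.
  apply: (cvg_comp y psi) cvg_psi.
  apply/cvgryPge => A; near=> m.
  have h : A / Num.sqrt pi <= m.+1%:R.
    near: m; exists (Num.bound `|A / Num.sqrt pi|) => // m /= bm.
    apply: le_trans (ler_norm _) _; apply: le_trans (ltW (archi_boundP (normr_ge0 _))) _.
    by rewrite ler_nat (leq_trans bm).
  rewrite ler_pdivrMr// in h; apply: le_trans h _.
  rewrite /y /eps mulrA ler_pdivlMr// -mulrA [_ * m.+1%:R]mulrC mulrA.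
  by rewrite ler_pM2r// -natrM ler_nat.
move=> m; have sum_ge N : psi (N.+1%:R * eps m) - psi (eps m) <=
    \sum_(k < N) eps m * poisson_tail ((k.+1%:R * eps m) ^+ 2).
  elim: N => [|N IH]; first by rewrite big_ord0 mul1r subrr.
  rewrite big_ord_recr/=.
  have := @psi_step (N.+1%:R * eps m) (N.+2%:R * eps m).
  rewrite mulr_gt0// ler_pM2r// ler_nat leqnSn => /(_ isT isT).
  have -> : N.+2%:R * eps m - N.+1%:R * eps m = eps m by rewrite -[N.+2%:R]natr1; ring.
  by rewrite [poisson_tail _ * _]mulrC; lra.
have small : psi (eps m) <= 5 / 2 * eps m.
  have := integral0_gauss_le (eps0 m).
  have : 0 <= eps m * expR (- eps m ^+ 2) by rewrite mulr_ge0 ?expR_ge0// ltW.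
  by rewrite /psi; lra.
have -> : \sum_(k < m.+1 * m.+1) poisson_tail (pi * (k.+1%:R / m.+1%:R) ^+ 2) =
    \sum_(k < m.+1 * m.+1) poisson_tail ((k.+1%:R * eps m) ^+ 2).
  apply: eq_bigr => k _; congr poisson_tail; rewrite -{1}sp2 /eps -exprMn; congr (_ ^+ 2); ring.
have -> : m.+1%:R^-1 = (Num.sqrt pi)^-1 * eps m :> R.
  by rewrite /eps mulrA mulVf ?mul1r// gt_eqF.
rewrite [5 / 2 * _]mulrCA -mulrBr -[leRHS]mulrA ler_pM2l ?invr_gt0// mulr_sumr.
by apply: le_trans (sum_ge _); rewrite -/(y m) lerB.
Unshelve. all: end_near. Qed.

End GaussSum.


(** * Choice of the constants *)

Section Constants.
Variable R : realType.

Definition iso_radius : R := Num.sqrt (2 / pi).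
Definition shift_step : R := 3 / 100 * iso_radius.
Definition annulus_radius (b : nat) : R := Num.sqrt ((2 + b%:R / 100) / pi).

Let s := iso_radius.
Let u := shift_step.
Let r := annulus_radius.

Lemma pi_iso_radius : pi * s ^+ 2 = 2.
Proof.
rewrite /s /iso_radius sqr_sqrtr; last by rewrite divr_ge0// pi_ge0.
by rewrite mulrC divfK// gt_eqF// pi_gt0.
Qed.

Lemma pi_annulus_radius b : pi * r b ^+ 2 = 2 + b%:R / 100.
Proof.
rewrite /r /annulus_radius sqr_sqrtr; last by rewrite divr_ge0 ?pi_ge0// addr_ge0// divr_ge0.
by rewrite mulrC divfK// gt_eqF// pi_gt0.
Qed.

Lemma annulus_radius0 : r 0%N = s.
Proof. by rewrite /r /annulus_radius mul0r addr0. Qed.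

Lemma annulus_radius_homo : {homo r : a b / (a <= b)%N >-> a <= b}.
Proof.
move=> a b ab; rewrite /r /annulus_radius ler_wsqrtr// ler_pM2r ?invr_gt0 ?pi_gt0//.
by rewrite lerD2l ler_pM2r ?invr_gt0// ler_nat.
Qed.

(** The crude bound [pi <= 4] is enough. *)
Lemma iso_radius_ge : 7 / 10 <= s.
Proof.
have pi4 : pi <= 4 :> R by have /andP[_] := (pihalf_02_cos_pihalf R).1; lra.
have e0 : 0 <= 7 / 10 :> R by lra.
have e2 : (7 / 10) ^+ 2 <= 2 / pi :> R by rewrite ler_pdivlMr ?pi_gt0//; lra.
by rewrite -(ger0_norm e0) -sqrtr_sqr; exact: ler_wsqrtr.
Qed.

Lemma expR_opp_le (y E : R) : 0 <= y -> 0 < E ->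
  1 <= E * (1 + y + y ^+ 2 / 2 + y ^+ 3 / 6 + y ^+ 4 / 24 + y ^+ 5 / 120) ->
  expR (- y) <= E.
Proof.
move=> y0 E0 h; have := expR_ge_partial 6 y0.
rewrite !big_nat_recr//= big_geq// add0r => h2.
rewrite expRN -[leRHS]invrK lef_pV2 ?posrE ?expR_gt0 ?invr_gt0//.
rewrite -[E^-1]mul1r ler_pdivrMr//; apply: le_trans h _; rewrite mulrC ler_pM2r//.
apply: le_trans h2; rewrite expr0 expr1 (_ : 0`! = 1)%N// (_ : 1`! = 1)%N//.
rewrite (_ : 2`! = 2)%N// (_ : 3`! = 6)%N// (_ : 4`! = 24)%N// (_ : 5`! = 120)%N//.
lra.
Qed.

Lemma expR_opp2_ge : 126 / 1000 <= expR (- 2) :> R.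
Proof.
have -> : - 2 = 32%:R * - (16^-1) :> R by lra.
rewrite expRM_natl; apply: (@le_trans _ _ ((15 / 16) ^+ 32)); first lra.
have h : 15 / 16 <= expR (- 16^-1) :> R.
  by apply: le_trans (expR_ge1Dx _); lra.
have h0 : 0 <= 15 / 16 :> R by lra.
by apply: lerXn2r; rewrite // nnegrE expR_ge0.
Qed.

(** A shift by [(1 - theta) * s] leaves discs of radius [theta * s] at distance [s].
    The exponent [y] is [2 * (theta ^+ 2 - 1 / 2)], diminished by the area [1 / 100]
    of the annuli. *)
Lemma nonpaying_le (theta E : R) B : 85 / 100 <= theta -> theta <= 1 -> 0 < E ->
  let y := 2 * theta ^+ 2 - 101 / 100 in
  1 <= E * (1 + y + y ^+ 2 / 2 + y ^+ 3 / 6 + y ^+ 4 / 24 + y ^+ 5 / 120) ->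
  \sum_(b < B) (pi * r b.+1 ^+ 2 - pi * r b ^+ 2) *
    (expR (- (pi * (r b - (1 - theta) * s) ^+ 2 - pi * s ^+ 2 / 2)) *
       (1 + (pi * (r b - (1 - theta) * s) ^+ 2 - pi * s ^+ 2 / 2)))
  <= E * (1 + 2 * theta ^+ 2) / theta.
Proof.
move=> th0 th1 E0 y hE.
have tp : 0 < theta by lra.
have s0 : 0 < s by apply: lt_le_trans iso_radius_ge; lra.
have rs b : s <= r b by rewrite -annulus_radius0 annulus_radius_homo.
have rdl b : pi * r b.+1 ^+ 2 - pi * r b ^+ 2 = 1 / 100.
  by rewrite !pi_annulus_radius -natr1; field.
have y0 : 0 <= y by rewrite /y; nra.
have := @annuli_tail_sum R r s ((1 - theta) * s) theta (1 / 100) B tp th1 s0 erefl _ rs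
  annulus_radius0 annulus_radius_homo rdl.
rewrite pi_iso_radius => h; apply: le_trans (h _ _) _; [lra|nra|].
rewrite /poisson_tail mulrAC ler_pM2r ?invr_gt0// mulrA -expRD.
have -> : 1 / 100 - 2 * (theta ^+ 2 - 2^-1) = - y by rewrite /y; field.
have -> : 2 + 2 * (theta ^+ 2 - 2^-1) = 1 + 2 * theta ^+ 2 by field.
rewrite ler_pM2r; first exact: expR_opp_le.
by have := sqr_ge0 theta; lra.
Qed.

(** Upper bounds for [exp (1 / 100) / theta] times [poisson_tail] at
   [2 * theta ^+ 2 - 1] for [theta] = 0.97, 0.94, 0.91, 0.88, 0.85. *)
Let shift_bound (k : nat) : R := nth 0 [:: 1245; 1384; 1533; 1692; 1864] k / 1000.

Let nonpaying_shift (k : 'I_5) B :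
  \sum_(b < B) (pi * r b.+1 ^+ 2 - pi * r b ^+ 2) *
    (expR (- (pi * (r b - k.+1%:R * u) ^+ 2 - pi * s ^+ 2 / 2)) *
       (1 + (pi * (r b - k.+1%:R * u) ^+ 2 - pi * s ^+ 2 / 2))) <= shift_bound k.
Proof.
have -> : k.+1%:R * u = (1 - (1 - k.+1%:R * (3 / 100))) * s by rewrite /u /shift_step -/s; field.
move: k => [[|[|[|[|[|k]]]]] k5] //=; rewrite /shift_bound/=.
- apply: le_trans (@nonpaying_le _ (419 / 1000) _ _ _ _ _) _; [lra|lra|lra|lra|].
  by rewrite ler_pdivrMr; lra.
- apply: le_trans (@nonpaying_le _ (470 / 1000) _ _ _ _ _) _; [lra|lra|lra|lra|].
  by rewrite ler_pdivrMr; lra.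
- apply: le_trans (@nonpaying_le _ (525 / 1000) _ _ _ _ _) _; [lra|lra|lra|lra|].
  by rewrite ler_pdivrMr; lra.
- apply: le_trans (@nonpaying_le _ (584 / 1000) _ _ _ _ _) _; [lra|lra|lra|lra|].
  by rewrite ler_pdivrMr; lra.
- apply: le_trans (@nonpaying_le _ (648 / 1000) _ _ _ _ _) _; [lra|lra|lra|lra|].
  by rewrite ler_pdivrMr; lra.
Qed.

Lemma score_limit_ge (J B : nat) :
  J%:R^-1 * \sum_(k < J * J) poisson_tail (pi * (k.+1%:R / J%:R) ^+ 2) + u * (expR (- 2) * (2282 / 1000))
   <= score_limit J (J * J) 5 B s u r.
Proof.
have u0 : 0 <= u.
  by rewrite /u /shift_step; have := iso_radius_ge; rewrite -/s; lra.
rewrite /score_limit; apply: lerD.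
  rewrite le_eqVlt; apply/orP; left; apply/eqP; congr (_ * _); apply: eq_bigr => k _.
  by rewrite /poisson_tail addr0 add0r; ring.
rewrite ler_wpM2l//.
have -> : 2282 / 1000 = \sum_(k < 5) (2 - shift_bound k) :> R.
  by rewrite !big_ord_recr big_ord0/= /shift_bound/=; lra.
rewrite mulr_sumr; apply: ler_sum => k _.
rewrite pi_iso_radius addr0 addr0 mulr1 mul1r.
under eq_bigr => b _ do rewrite opprD expRD -mulrA mulrCA.
rewrite -mulr_sumr [2 * _]mulrC -mulrBr ler_pM2l ?expR_gt0// lerB//.
by have := nonpaying_shift k B; rewrite pi_iso_radius.
Qed.

Lemma iso_radius_gt0 : 0 < s.
Proof. by have := iso_radius_ge; lra. Qed.

Lemma shift_step_gt0 : 0 < u.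
Proof. by rewrite /u /shift_step -/s; have := iso_radius_gt0; lra. Qed.

Lemma total_shift_lt : 5%:R * u < s.
Proof. by rewrite /u /shift_step -/s; have := iso_radius_gt0; lra. Qed.

Lemma total_shift_sep : s ^+ 2 / 2 < (s - 5%:R * u) ^+ 2.
Proof.
have -> : s - 5%:R * u = 17 / 20 * s by rewrite /u /shift_step -/s; field.
have : 0 < s ^+ 2 by rewrite exprn_gt0// iso_radius_gt0.
by rewrite exprMn; lra.
Qed.

Lemma annuli_cover (K : R) : 0 < K -> exists B, K < r B.
Proof.
move=> K0; exists (Num.bound (100 * (pi * K ^+ 2))).
have b0 : 0 <= 100 * (pi * K ^+ 2) by apply: mulr_ge0 => //; apply: mulr_ge0; [exact: pi_ge0|exact: sqr_ge0].
move: (archi_boundP b0); set b : R := (Num.bound _)%:R => hB.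
rewrite /r /annulus_radius -/b -(ger0_norm (ltW K0)) -sqrtr_sqr ltr_sqrt; last first.
  by rewrite divr_gt0 ?pi_gt0//; lra.
by rewrite ltr_pdivlMr ?pi_gt0// mulrC; lra.
Qed.

(** [2282 / 1000] is the sum over the five shifts of [2 - shift_bound k]. *)
Definition gain : R := u * (expR (- 2) * (2282 / 1000)).

Lemma target_le_gain : 5 / 8 + 1 / 2 * (19 / 10368) + 1 / 2 * ((3072 * Num.sqrt 2 - 4325) / 5376)
  <= 5 / 8 + gain / 2.
Proof.
have s2 : Num.sqrt 2 ^+ 2 = 2 :> R by rewrite sqr_sqrtr.
have sq0 : 0 <= Num.sqrt 2 :> R by exact: sqrtr_ge0.
have sq : Num.sqrt 2 <= 14143 / 10000 :> R by nra.
have gain_ge : 3 / 100 * (7 / 10) * (126 / 1000 * (2282 / 1000)) <= gain.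
  have e2 := expR_opp2_ge; have sr := iso_radius_ge.
  rewrite /gain; apply: ler_pM; [lra|lra| |lra].
  by rewrite /u /shift_step -/s; lra.
lra.
Qed.

Lemma target_ge : (6277 / 10000 : R) <=
  5 / 8 + 1 / 2 * (19 / 10368) + 1 / 2 * ((3072 * Num.sqrt 2 - 4325) / 5376).
Proof.
have s2 : Num.sqrt 2 ^+ 2 = 2 :> R by rewrite sqr_sqrtr.
have sq0 : 0 <= Num.sqrt 2 :> R by exact: sqrtr_ge0.
have sq : 14142 / 10000 <= Num.sqrt 2 :> R by nra.
lra.
Qed.

End Constants.


Theorem theorem4 (R : realType) (d : measure_display) (T : measurableType d)
  (P : probability T R) (X : nat -> {RV P >-> (R * R)%type}) (beta : R)
  (iidX : iid_uniform_unit_square P X)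
  (betaP : {ae P, forall w : T,
     (fun n : nat => tsp_length (fun i : 'I_n => X i w) / Num.sqrt (n%:R : R))
       @ \oo --> beta}) :
  5 / 8 + 1 / 2 * (19 / 10368)
    + 1 / 2 * ((3072 * Num.sqrt 2 - 4325) / 5376) <= beta /\
  (6277 / 10000 : R) <=
    5 / 8 + 1 / 2 * (19 / 10368)
      + 1 / 2 * ((3072 * Num.sqrt 2 - 4325) / 5376).
Proof.
split; last exact: target_ge.
apply: (le_trans (target_le_gain R)).
set s := iso_radius R; set u := shift_step R.
have s0 : 0 < s by exact: iso_radius_gt0.
have u0 : 0 < u by exact: shift_step_gt0.
have [low low_cvg low_le] := gauss_riemann_sum R.
have key (m : nat) : low m + gain R <= (1 + 5%:R * u * m.+1%:R^-1) * 2 * beta.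
  (* The single parameter [K] fixes the step [1 / K] and the range [K] of the
     thresholds, the cut, and [eta = 5 * u / K]. *)
  pose K : R := m.+1%:R.
  have K0 : 0 < K by rewrite ltr0n.
  have [B KB] := annuli_cover K0.
  apply: (@le_trans _ _ (score_limit m.+1 (m.+1 * m.+1) 5 B s u (annulus_radius R))).
    by apply: le_trans (score_limit_ge R m.+1 B); rewrite lerD2r; exact: low_le.
  apply: (score_limit_le iidX betaP _ (isT : (0 < m.+1)%N) u0 s0 K0 (total_shift_lt R) (annulus_radius0 R)
    (@annulus_radius_homo R) KB (total_shift_sep R)).
    by rewrite mulr_ge0 ?invr_ge0 ?(ltW K0)// mulr_ge0// ltW.
  by rewrite divfK ?gt_eqF.
have lim : 5 / 4 + gain R <= (1 + 0) * 2 * beta.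
  have cl : (fun m => low m + gain R) @ \oo --> 5 / 4 + gain R.
    by apply: cvgD => //; exact: cvg_cst.
  have cr : (fun m => (1 + 5%:R * u * m.+1%:R^-1) * 2 * beta) @ \oo --> (1 + 0) * 2 * beta.
    apply: cvgM; last exact: cvg_cst.
    apply: cvgM; last exact: cvg_cst.
    apply: cvgD; first exact: cvg_cst.
    rewrite -[X in _ --> X](mulr0 (5%:R * u)).
    by apply: cvgM; [exact: cvg_cst|exact: cvg_harmonic].
  by apply: ler_cvg_to cl cr _; exact: nearW.
move: (gain R) lim => g; clear; lra.
Qed.
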